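(* For $N\ge0$ let $\mathcal D_N:\mathcal R\to\mathfrak Z_\infty$ be the unique $\mathbb F_p$-linear map with $\mathcal D_N(x_\varnothing)=1$ and, for non-empty $\mathbf s=(s_1,\dots,s_m)\in\mathbf I$, $$\mathcal D_N(x_{\mathbf s})=\sum_{\substack{n_1,\dots,n_m\ge0\\ n_1+\cdots+n_m=N}}\Bigl(\prod_{j=1}^m\binom{-s_j}{n_j}\Bigr)\zeta_A\bigl(s_1-n_1(r-1),\dots,s_m-n_m(r-1)\bigr).$$ Then $(\mathcal D_N)_{N\ge0}$ is a Hasse–Schmidt derivation over $\widehat{\zeta_A}$: $\mathcal D_0=\widehat{\zeta_A}$, and for all indices $\mathbf r,\mathbf s\in\mathbf I$ and all $N\ge0$, $$\mathcal D_N(x_{\mathbf r}\ast x_{\mathbf s})=\sum_{k=0}^N\mathcal D_k(x_{\mathbf r})\,\mathcal D_{N-k}(x_{\mathbf s}).$$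
   Context: Let $r$ be a power of a prime $p$, $A=\mathbb F_r[\theta]$, $K=\mathbb F_r(\theta)$, $K_\infty=\mathbb F_r((1/\theta))$; $A_{+,d}$ is the set of monic polynomials of degree $d$. $\mathbf I^{\mathrm{ext}}$ denotes finite tuples of integers and $\mathbf I$ finite tuples of positive integers (both including $\varnothing$). For $s,d\in\mathbb Z$, $S_d(s)=\sum_{a\in A_{+,d}}a^{-s}$; $S_{<d}(\mathbf s)=\sum_{d>d_1>\cdots>d_m\ge0}\prod_jS_{d_j}(s_j)$; $\zeta_A(\mathbf s)=\lim_{d\to\infty}S_{<d}(\mathbf s)\in K_\infty$ for all $\mathbf s\in\mathbf I^{\mathrm{ext}}$, $\zeta_A(\varnothing)=1$; $\mathfrak Z_\infty$ is the $K$-subalgebra of $K_\infty$ generated by all $\zeta_A(\mathbf s)$. Binomial coefficients are taken in $\mathbb F_p$. The $r$-shuffle algebra: $\mathcal R$ is the $\mathbb F_p$-vector space with basis the free monoid on symbols $x_k$ ($k\in\mathbb N$); for $\mathbf s=(s_1,\dots,s_m)\in\mathbf I$ write $x_{\mathbf s}=x_{s_1}\cdots x_{s_m}$, $x_\varnothing=1$, $\mathbf s^-=(s_2,\dots,s_m)$. For $r_1,s_1\in\mathbb N$ and positive integers $i,j$, $\Delta^{i,j}_{r_1,s_1}=(-1)^{r_1-1}\binom{j-1}{r_1-1}+(-1)^{s_1-1}\binom{j-1}{s_1-1}$ if $(r-1)\mid j$ and $0$ otherwise. The product $\ast$ is the $\mathbb F_p$-bilinear product defined by induction on total depth: $1\ast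 x_{\mathbf s}=x_{\mathbf s}\ast1=x_{\mathbf s}$, and for non-empty $\mathbf r=(r_1,\dots),\mathbf s=(s_1,\dots)$: $x_{\mathbf r}\ast x_{\mathbf s}=x_{r_1}(x_{\mathbf r^-}\ast x_{\mathbf s})+x_{s_1}(x_{\mathbf r}\ast x_{\mathbf s^-})+x_{r_1+s_1}(x_{\mathbf r^-}\ast x_{\mathbf s^-})+\sum_{i+j=r_1+s_1}\Delta^{i,j}_{r_1,s_1}x_i\bigl((x_{\mathbf r^-}\ast x_{\mathbf s^-})\ast x_j\bigr)$, where juxtaposition is concatenation (extended linearly). $\widehat{\zeta_A}:\mathcal R\to\mathfrak Z_\infty$ is the $\mathbb F_p$-linear map $x_{\mathbf s}\mapsto\zeta_A(\mathbf s)$, $1\mapsto1$. A Hasse–Schmidt derivation over a homomorphism $f$ is a sequence of linear maps $(D_N)$ with $D_0=f$ and $D_N(xy)=\sum_{k=0}^ND_k(x)D_{N-k}(y)$.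
   Formalization: The value on the empty word is corrected to D_0(x_∅)=1 and D_N(x_∅)=0 for N≥1, since with D_N(x_∅)=1 for all N the product rule fails at r=s=∅, N=1 (1 versus 2); the identity for non-empty r and s is unchanged. *)

(* Defs.v *)
From HB Require Import structures.
From mathcomp Require Import all_boot all_order all_algebra.
From mathcomp Require Import all_field.
From mathcomp Require Import boolp classical_sets functions filter topology.
From mathcomp.multinomials Require Import freeg.

Set Implicit Arguments.
Unset Strict Implicit.
Unset Printing Implicit Defensive.

Import Order.TTheory GRing.Theory Num.Theory.

Local Open Scope classical_set_scope.
Local Open Scope ring_scope.

Record pseries (F : fieldType) := PSeries { pcoef : nat -> F }.

Section PowerSeries.
Variable F : fieldType.
Local Notation ps := (pseries F).
Implicit Types f g h : ps.

HB.instance Definition _ := [isNew for @pcoef F].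
HB.instance Definition _ := [Choice of ps by <:].

Lemma pseriesP f g : pcoef f =1 pcoef g -> f = g.
Proof. by case: f g => [f] [g] /= fg; congr PSeries; apply/funext. Qed.

Definition padd f g : ps := PSeries (fun n => pcoef f n + pcoef g n).
Definition popp f : ps := PSeries (fun n => - pcoef f n).
Definition pconst (c : F) : ps := PSeries (fun n => if n == 0%N then c else 0).
Definition pvar : ps := PSeries (fun n => (n == 1%N)%:R).
Definition pmul f g : ps :=
  PSeries (fun n => \sum_(i < n.+1) pcoef f i * pcoef g (n - i)%N).

Fact paddA : associative padd.
Proof. by move=> f g h; apply: pseriesP => n /=; rewrite addrA. Qed.
Fact paddC : commutative padd.
Proof. by move=> f g; apply: pseriesP => n /=; rewrite addrC. Qed.
Fact padd0 : left_id (pconst 0) padd.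
Proof. by move=> f; apply: pseriesP => n /=; rewrite if_same add0r. Qed.
Fact paddN : left_inverse (pconst 0) popp padd.
Proof. by move=> f; apply: pseriesP => n /=; rewrite if_same addNr. Qed.

HB.instance Definition _ := GRing.isZmodule.Build ps paddA paddC padd0 paddN.

Let tr n f : {poly F} := \poly_(i < n.+1) pcoef f i.

Let pmulE n k f g : (k <= n)%N -> pcoef (pmul f g) k = (tr n f * tr n g)`_k.
Proof.
move=> kn; rewrite coefM /=; apply: eq_bigr => i _.
rewrite !coef_poly !ltnS (leq_trans (leq_subr _ _) kn).
by rewrite (leq_trans _ kn) // -ltnS.
Qed.

Fact pmulA : associative pmul.
Proof.
move=> f g h; apply: pseriesP => n.
have -> : pcoef (pmul f (pmul g h)) n = (tr n f * (tr n g * tr n h))`_n.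
  rewrite coefM /=; apply: eq_bigr => i _.
  rewrite coef_poly ltn_ord; congr (_ * _).
  by rewrite -(@pmulE n) // leq_subr.
rewrite mulrA coefM; apply: eq_bigr => i _.
rewrite -(@pmulE n i) //; last by rewrite -ltnS.
by rewrite coef_poly ltnS leq_subr.
Qed.

Fact pmulC : commutative pmul.
Proof. by move=> f g; apply: pseriesP => n; rewrite !(@pmulE n) // mulrC. Qed.

Fact pmul1 : left_id (pconst 1) pmul.
Proof.
move=> f; apply: pseriesP => n /=.
by rewrite big_ord_recl /= mul1r subn0 big1 ?addr0 // => i _; rewrite mul0r.
Qed.

Fact pmulDl : left_distributive pmul padd.
Proof.
move=> f g h; apply: pseriesP => n /=.
by rewrite -big_split /=; apply: eq_bigr => i _; rewrite mulrDl.
Qed.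

Fact pone_neq0 : pconst 1 != 0.
Proof.
apply/eqP => /(congr1 (fun f => pcoef f 0)) /= /eqP.
by rewrite (negPf (oner_neq0 _)).
Qed.

HB.instance Definition _ := GRing.Zmodule_isComNzRing.Build ps
  pmulA pmulC pmul1 pmulDl pone_neq0.

(* pinvs f n lists the coefficients of index n, n - 1, ..., 0 of 1 / f. *)
Fixpoint pinvs f n : seq F :=
  if n is n'.+1 then
    - (pcoef f 0)^-1 * (\sum_(i < n) pcoef f i.+1 * (pinvs f n')`_i)
      :: pinvs f n'
  else [:: (pcoef f 0)^-1].

Definition punit : pred ps := fun f => pcoef f 0 != 0.
Definition pinv f : ps :=
  if punit f then PSeries (fun n => (pinvs f n)`_0) else f.

Let nth_pinvs f n i : (i <= n)%N -> (pinvs f n)`_i = (pinvs f (n - i))`_0.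
Proof. by elim: n i => [|n IHn] [|i] //= /IHn ->. Qed.

Fact pmulV : {in punit, left_inverse 1 pinv *%R}.
Proof.
move=> f fU; rewrite [_ * _]pmulC; apply: pseriesP => n.
have f0 : pcoef f 0 != 0 by [].
rewrite /pinv (_ : punit f = true) //.
case: n => [|n] /=; first by rewrite big_ord1 divff.
rewrite big_ord_recl /= mulrA mulrN divff // mulN1r.
apply/eqP; rewrite addrC subr_eq0; apply/eqP; apply: eq_bigr => i _.
by rewrite (@nth_pinvs f n i) -1?ltnS // /bump leq0n add1n subSS.
Qed.

Fact pinvP f g : g * f = 1 -> punit f.
Proof.
move/(congr1 (fun f => pcoef f 0)); rewrite /= big_ord1 /= => gf1.
by apply/eqP => f0; move/eqP: gf1; rewrite f0 mulr0 eq_sym oner_eq0.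
Qed.

Fact pinv_out : {in [predC punit], pinv =1 id}.
Proof. by move=> f fU; rewrite /pinv; case: ifP => // fT; case/negP: fU. Qed.

HB.instance Definition _ := GRing.ComNzRing_hasMulInverse.Build ps
  pmulV pinvP pinv_out.

Lemma pseries_order f :
  f != 0 -> exists2 n, pcoef f n != 0 & forall i, (i < n)%N -> pcoef f i = 0.
Proof.
move=> f0; have ex : exists n, pcoef f n != 0.
  apply: contrapT => /forallNP fn; move/eqP: f0; apply; apply: pseriesP => n /=.
  by rewrite if_same; apply/eqP/negPn/negP/fn.
exists (ex_minn ex); first by case: ex_minnP.
case: ex_minnP => n _ nmin i; apply: contraTeq => /nmin.
by rewrite -leqNgt.
Qed.

Fact pmul_eq0 f g : f * g = 0 -> (f == 0) || (g == 0).
Proof.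
move=> fg; apply: contraT; rewrite negb_or.
case/andP=> /pseries_order[m fm fmin] /pseries_order[n gn gmin].
suff /eqP : pcoef f m * pcoef g n = 0 by rewrite mulf_eq0 (negPf fm) (negPf gn).
have := congr1 (fun h => pcoef h (m + n)%N) fg; rewrite /= if_same.
have mn : (m < (m + n).+1)%N by rewrite ltnS leq_addr.
rewrite (bigD1 (Ordinal mn)) //= addKn big1 ?addr0 // => i.
rewrite -val_eqE /= neq_ltn => /orP[/fmin->|mi]; first by rewrite mul0r.
by rewrite gmin ?mulr0 // ltn_subLR ?ltn_add2r // -ltnS.
Qed.

HB.instance Definition _ := GRing.ComUnitRing_isIntegral.Build ps pmul_eq0.

End PowerSeries.

(* The field F((1/theta)), as the fraction field of the ring of power series
   in u = 1/theta; see laurent_expansion below. *)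
Definition Kinf (F : fieldType) : Type := {fraction (pseries F)}.
HB.instance Definition _ (F : fieldType) := GRing.Field.on (Kinf F).

Section Laurent.
Variable F : fieldType.

Definition of_pseries (f : pseries F) : Kinf F := tofrac f.
Definition theta : Kinf F := (of_pseries (pvar F))^-1.

(* The embedding of A = F[theta] into Kinf F. *)
Definition of_poly (a : {poly F}) : Kinf F :=
  (map_poly (fun c : F => of_pseries (pconst c)) a).[theta].

Lemma pvarXn_coef n k : pcoef (pvar F ^+ n) k = (k == n)%:R.
Proof.
elim: n k => [|n IHn] k; first by rewrite expr0 /=; case: eqP.
rewrite exprS /=; case: k => [|k]; first by rewrite big_ord1 /= mul0r.
rewrite 2!big_ord_recl /= mul0r add0r mul1r subSS subn0 IHn eqSS.
by rewrite big1 ?addr0 // => i _; rewrite mul0r.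
Qed.

Lemma pvarXn_coefM n f k :
  pcoef (pvar F ^+ n * f) k = if (k < n)%N then 0 else pcoef f (k - n).
Proof.
rewrite /=; case: ltnP => kn.
  rewrite big1 // => i _; rewrite pvarXn_coef.
  suff -> : (i : nat) == n = false by rewrite mul0r.
  by apply/negbTE; rewrite neq_ltn (leq_ltn_trans _ kn) // -ltnS.
have nk : (n < k.+1)%N by [].
rewrite (bigD1 (Ordinal nk)) //= pvarXn_coef eqxx mul1r big1 ?addr0 // => i.
by rewrite -val_eqE pvarXn_coef /= => /negPf ->; rewrite mul0r.
Qed.

Lemma of_pseriesM : {morph of_pseries : f g / f * g}.
Proof. exact: rmorphM. Qed.

Lemma of_pseries_eq0 f : (of_pseries f == 0) = (f == 0).
Proof. exact: tofrac_eq0. Qed.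

Lemma fraction_quotient (R : idomainType) (x : {fraction R}) :
  exists a b : R, b != 0 /\ x = tofrac a / tofrac b.
Proof.
elim/quotW: x => x; exists \n_x, \d_x; split.
  exact: denom_ratioP.
unlock tofrac; rewrite -[X in _ = _ * X]FracField.pi_inv -[RHS]FracField.pi_mul.
rewrite /FracField.mulf /FracField.invf.
by rewrite !numden_Ratio ?oner_neq0 ?mulr1 ?mul1r ?denom_ratioP // Ratio_numden.
Qed.

Lemma laurent_expansion (x : Kinf F) :
  exists n f, x = theta ^+ n * of_pseries f.
Proof.
have [[a b] /= b0 ->] : exists2 ab : pseries F * pseries F, ab.2 != 0 &
    x = of_pseries ab.1 / of_pseries ab.2.
  by have [a [b [b0 xE]]] := fraction_quotient x; exists (a, b).
have [n bn bmin] := pseries_order b0.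
pose c : pseries F := PSeries (fun k => pcoef b (k + n)%N).
have cU : c \is a GRing.unit by [].
have bE : b = pvar F ^+ n * c.
  apply: pseriesP => k; rewrite pvarXn_coefM.
  by case: ltnP => [/bmin//|nk] /=; rewrite subnK.
exists n, (a * c^-1); rewrite bE !of_pseriesM invfM.
rewrite /of_pseries rmorphV //= rmorphXn /= /theta -exprVn.
by rewrite mulrCA.
Qed.

End Laurent.

(* The 1/theta-adic topology: y is in the n-th ball around x when y - x has
   no term in theta^k for k > - n. *)
Section Topology.
Variable F : fieldType.
Local Notation K := (Kinf F).

HB.instance Definition _ := isPointed.Build K 0.

Definition Kball (x : K) (n : nat) : set K :=
  [set y | exists f : pseries F, y = x + of_pseries f / theta F ^+ n].
Definition Knbhs (x : K) : set_system K :=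
  [set A | exists n, Kball x n `<=` A].

HB.instance Definition _ := hasNbhs.Build K Knbhs.

Fact Knbhs_filter (x : K) : ProperFilter (nbhs x).
Proof.
have ball_refl n : Kball x n x.
  by exists 0; rewrite /of_pseries rmorph0 mul0r addr0.
apply: Build_ProperFilter_ex => [A [n xA]|]; first by exists x; apply: xA.
split=> [|A B [m mA] [n nB]|A B AB [n nA]].
- by exists 0%N.
- have le_ball k l : (k <= l)%N -> Kball x l `<=` Kball x k.
    move=> kl y [f ->]; exists (f * pvar F ^+ (l - k)).
    have -> : of_pseries (f * pvar F ^+ (l - k)) =
        of_pseries f / theta F ^+ (l - k).
      by rewrite of_pseriesM /of_pseries rmorphXn /= /theta exprVn invrK.
    by rewrite -mulrA -invfM -exprD subnK.
  exists (maxn m n) => y ymn; split.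
    by apply: mA; apply: le_ball ymn; rewrite leq_maxl.
  by apply: nB; apply: le_ball ymn; rewrite leq_maxr.
- by exists n => y /nA /AB.
Qed.

Fact Knbhs_singleton (x : K) (A : set K) : nbhs x A -> A x.
Proof.
by case=> n; apply; exists 0; rewrite /of_pseries rmorph0 mul0r addr0.
Qed.

Fact Knbhs_nbhs (x : K) (A : set K) : nbhs x A -> nbhs x (nbhs^~ A).
Proof.
case=> n nA; exists n => _ [f ->]; exists n => _ [g ->]; apply: nA.
by exists (f + g); rewrite /of_pseries rmorphD mulrDl addrA.
Qed.

HB.instance Definition _ :=
  Nbhs_isNbhsTopological.Build K Knbhs_filter Knbhs_singleton Knbhs_nbhs.

Lemma Kinf_hausdorff : hausdorff_space K.
Proof.
move=> x y /= xy; apply/eqP; rewrite eq_sym -subr_eq0; apply/negPn/negP => yx0.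
have [m [h hE]] := laurent_expansion (y - x).
have h0 : h != 0.
  by apply: contraNneq yx0 => h0; rewrite hE h0 /of_pseries rmorph0 mulr0.
have [k hk _] := pseries_order h0.
pose N := (m + k).+1.
have [||_ [[f ->] [g fg]]] := xy (Kball x N) (Kball y N).
- by exists N.
- by exists N.
have t0 : theta F != 0.
  rewrite invr_eq0 of_pseries_eq0; apply/eqP => /(congr1 (fun f => pcoef f 1)).
  by move/eqP; rewrite /= oner_eq0.
have yxE : y - x = of_pseries (f - g) / theta F ^+ N.
  rewrite /of_pseries rmorphB mulrBl; apply/eqP.
  by rewrite subr_eq addrAC eq_sym subr_eq addrC fg.
have hE' : h = pvar F ^+ (m + N) * (f - g).
  apply/eqP; rewrite -tofrac_eq; apply/eqP.
  rewrite -/(of_pseries h) -/(of_pseries (_ * _)) of_pseriesM.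
  have -> : of_pseries h = (y - x) / theta F ^+ m.
    by rewrite hE [_ * of_pseries h]mulrC (mulfK (expf_neq0 m t0)).
  have -> : of_pseries (pvar F ^+ (m + N)) = (theta F ^+ N * theta F ^+ m)^-1.
    by rewrite -exprD addnC /of_pseries rmorphXn /= /theta exprVn invrK.
  by rewrite yxE -[LHS]mulrA -[X in _ * X]invfM [LHS]mulrC.
move: hk; rewrite hE' pvarXn_coefM.
by rewrite /N addnS ltnS !addnA leq_addl eqxx.
Qed.

End Topology.

Section Zeta.
Variable F : finFieldType.
Local Notation K := (Kinf F).

(* S_d(s), the sum of a^-s over the monic polynomials a of degree d. *)
Definition power_sum (d : nat) (s : int) : K :=
  \sum_(a : {poly_d.+1 F} | ((a : {poly F}) \is monic) && (size a == d.+1))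
    of_poly a ^ (- s).

(* S_{<d}(s_1, ..., s_m), a sum over d > d_1 > ... > d_m >= 0. *)
Definition multi_power_sum (d : nat) (s : seq int) : K :=
  \sum_(t : (size s).-tuple 'I_d | sorted (fun i j : 'I_d => j < i)%N t)
    \prod_(j < size s) power_sum (tnth t j) s`_j.

Definition zetaA (s : seq int) : K :=
  lim ((fun d : nat => multi_power_sum d s) @ \oo).

Lemma multi_power_sum_nil d : multi_power_sum d [::] = 1.
Proof.
rewrite /multi_power_sum (bigD1 [tuple]) //= big_ord0 big1 ?addr0 // => t.
by case/andP => _ /eqP[]; apply/val_inj; rewrite /= (tuple0 t).
Qed.

Lemma zetaA_nil : zetaA [::] = 1.
Proof.
rewrite /zetaA (_ : (fun d => _) = fun=> 1); last first.
  by apply/funext => d; rewrite multi_power_sum_nil.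
by apply: cvg_lim; [exact: Kinf_hausdorff | exact: cvg_cst].
Qed.

Definition in_Ktheta (x : K) : Prop :=
  exists a b : {poly F}, b != 0 /\ x = of_poly a / of_poly b.

Definition is_Ksubalgebra (S : set K) : Prop :=
  [/\ in_Ktheta `<=` S,
      forall x y, S x -> S y -> S (x + y) &
      forall x y, S x -> S y -> S (x * y)].

Definition Zinf : set K := smallest is_Ksubalgebra (range zetaA).

End Zeta.

(* The letters x_k, k >= 1, and the words in them, i.e. the indices in I. *)
Definition letter := {k : nat | (0 < k)%N}.
HB.instance Definition _ := Choice.on letter.
Definition word := seq letter.
HB.instance Definition _ := Choice.on word.

(* Only used at k > 0; the value at k = 0 is irrelevant. *)
Definition mkletter (k : nat) : letter := insubd (exist _ 1%N isT : letter) k.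

Section Shuffle.
Variables p r : nat.

Definition shuffle_alg := {freeg word / 'F_p}.
HB.instance Definition _ := GRing.Lmodule.on shuffle_alg.
Local Notation R := shuffle_alg.

Definition xmon (w : word) : R := << w >>.

Definition lconcat (k : letter) (x : R) : R :=
  fglift (fun w => xmon (k :: w) : R) x.

Definition Delta (r1 s1 j : nat) : 'F_p :=
  if (r - 1 %| j)%N then
    (-1) ^+ (r1 - 1) * 'C(j - 1, r1 - 1)%:R +
    (-1) ^+ (s1 - 1) * 'C(j - 1, s1 - 1)%:R
  else 0.

(* The product of two words; n bounds the total depth, and serves only to make
   the recursion structural (see shuffle_rec). *)
Fixpoint shuffle_fuel (n : nat) (u v : word) : R :=
  match u, v, n with
  | [::], _, _ => xmon v
  | _, [::], _ => xmon u
  | a :: u', b :: v', n'.+1 =>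
      lconcat a (shuffle_fuel n' u' v)
      + lconcat b (shuffle_fuel n' u v')
      + lconcat (mkletter (val a + val b)) (shuffle_fuel n' u' v')
      + \sum_(1 <= j < val a + val b)
          Delta (val a) (val b) j *:
            lconcat (mkletter (val a + val b - j))
              (fglift (fun w => shuffle_fuel n' w [:: mkletter j] : R)
                 (shuffle_fuel n' u' v'))
  | _, _, 0 => 0
  end.

Definition shuffle_word (u v : word) : R := shuffle_fuel (size u + size v) u v.

Definition shuffle (x y : R) : R :=
  fglift (fun u => fglift (fun v => shuffle_word u v : R) y : R) x.

Lemma fglift_dom (f : word -> R) (x : R) :
  fglift f x = \sum_(w <- dom x) coeff w x *: f w.
Proof. by rewrite -{1}[x]Freeg_dom fglift_Freeg /prelift big_map. Qed.

Lemma eq_fglift_dom (f g : word -> R) (x : R) :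
  {in dom x, f =1 g} -> fglift f x = fglift g x.
Proof.
move=> fg; rewrite !fglift_dom big_seq [RHS]big_seq.
by apply: eq_bigr => w /fg ->.
Qed.

Lemma fglift_xmon (f : word -> R) (w : word) : fglift f (xmon w) = f w.
Proof. by rewrite /xmon liftU scale1r. Qed.

Lemma fglift_bound (k l : nat) (f : word -> R) (x : R) :
  (forall w, (size w <= k)%N -> {in dom (f w), forall w', (size w' <= l)%N}) ->
  {in dom x, forall w, (size w <= k)%N} ->
  {in dom (fglift f x), forall w, (size w <= l)%N}.
Proof.
move=> fkl xk w; rewrite fglift_dom => /dom_sum_subset /flattenP[t].
case/mapP=> w'; rewrite mem_filter /= => w'x -> /domZ_subset.
by apply: fkl; apply: xk.
Qed.

Lemma dom_add_bound (l : nat) (x y : R) :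
  {in dom x, forall w, (size w <= l)%N} ->
  {in dom y, forall w, (size w <= l)%N} ->
  {in dom (x + y), forall w, (size w <= l)%N}.
Proof.
by move=> xl yl w /domD_subset; rewrite mem_cat => /orP[/xl|/yl].
Qed.

Lemma dom_xmon_bound (l : nat) (u : word) :
  (size u <= l)%N -> {in dom (xmon u), forall w : word, (size w <= l)%N}.
Proof. by move=> ul w; rewrite domU1 inE => /eqP->. Qed.

Lemma lconcat_bound (l : nat) (k : letter) (x : R) :
  {in dom x, forall w, (size w <= l)%N} ->
  {in dom (lconcat k x), forall w, (size w <= l.+1)%N}.
Proof. by apply: fglift_bound => w wl; apply: dom_xmon_bound. Qed.

Lemma shuffle_fuel_bound n u v :
  {in dom (shuffle_fuel n u v), forall w, (size w <= size u + size v)%N}.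
Proof.
elim: n u v => [|n IHn] [|a u] [|b v]; try exact: dom_xmon_bound;
  rewrite ?addn0; try exact: dom_xmon_bound.
  by move=> w; rewrite dom0.
rewrite [shuffle_fuel _ _ _]/=.
have uv := IHn u v.
have weak (x : R) : {in dom x, forall w, (size w <= size u + size v + 1)%N} ->
    forall k, {in dom (lconcat k x), forall w,
      (size w <= size (a :: u) + size (b :: v))%N}.
  move=> xb k; have := @lconcat_bound _ k _ xb; rewrite /= addn1 addSn addnS.
  exact.
do 3?apply: dom_add_bound.
- by apply: weak; rewrite -addnA addn1; apply: (IHn u (b :: v)).
- apply: weak; rewrite addn1 -addSn; exact: (IHn (a :: u) v).
- by apply: weak => w /uv wl; rewrite (leq_trans wl) // leq_addr.
- move=> w /dom_sum_subset /flattenP[t /mapP[j _ ->]] /domZ_subset.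
  apply: weak; apply: fglift_bound uv => w' w'l w'' /IHn /= /leq_trans; apply.
  by rewrite leq_add2r.
Qed.

Lemma shuffle_fuel_enough n m u v :
  (size u + size v <= n)%N -> (size u + size v <= m)%N ->
  shuffle_fuel n u v = shuffle_fuel m u v.
Proof.
elim: n m u v => [|n IHn] [|m] [|a u] [|b v] //=.
rewrite !addSn !ltnS => un um.
have un' : (size u + size v < n)%N by rewrite -addnS.
have um' : (size u + size v < m)%N by rewrite -addnS.
congr (_ + _ + _ + _).
- by rewrite (IHn m).
- by rewrite (IHn m) //= addSn.
- by rewrite (IHn m) // ltnW.
- apply: eq_bigr => j _; congr (_ *: lconcat _ _).
  rewrite (IHn m u v (ltnW un') (ltnW um')).
  apply: eq_fglift_dom => w /shuffle_fuel_bound wl.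
  by apply: IHn; rewrite addn1 (leq_ltn_trans wl).
Qed.

Lemma shuffle_fuelS n a b u v :
  shuffle_fuel n.+1 (a :: u) (b :: v) =
    lconcat a (shuffle_fuel n u (b :: v)) + lconcat b (shuffle_fuel n (a :: u) v)
    + lconcat (mkletter (val a + val b)) (shuffle_fuel n u v)
    + \sum_(1 <= j < val a + val b)
        Delta (val a) (val b) j *:
          lconcat (mkletter (val a + val b - j))
            (fglift (fun w => shuffle_fuel n w [:: mkletter j] : R)
               (shuffle_fuel n u v)).
Proof. by []. Qed.

Lemma shuffle_xmon u v : shuffle (xmon u) (xmon v) = shuffle_word u v.
Proof. by rewrite /shuffle !fglift_xmon. Qed.

Lemma shuffle1 u : shuffle (xmon u) (xmon [::]) = xmon u.
Proof. by rewrite shuffle_xmon /shuffle_word; case: u => //= a u; rewrite addn0. Qed.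

Lemma shuffle_rec (a b : letter) (u v : word) :
  shuffle (xmon (a :: u)) (xmon (b :: v)) =
    lconcat a (shuffle (xmon u) (xmon (b :: v)))
    + lconcat b (shuffle (xmon (a :: u)) (xmon v))
    + lconcat (mkletter (val a + val b)) (shuffle (xmon u) (xmon v))
    + \sum_(1 <= j < val a + val b)
        Delta (val a) (val b) j *:
          lconcat (mkletter (val a + val b - j))
            (shuffle (shuffle (xmon u) (xmon v)) (xmon [:: mkletter j])).
Proof.
rewrite !shuffle_xmon {1}/shuffle_word.
rewrite (@shuffle_fuel_enough _ (size u + size v).+2 (a :: u) (b :: v)).
- rewrite shuffle_fuelS; congr (_ + _ + _ + _).
  + by apply: congr1; apply: shuffle_fuel_enough; rewrite ?addnS.
  + by apply: congr1; apply: shuffle_fuel_enough; rewrite ?addSn.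
  + apply: eq_bigr => j _; congr (_ *: lconcat _ _).
    rewrite /shuffle /shuffle_word.
    rewrite (@shuffle_fuel_enough _ (size u + size v) u v (leqnSn _) (leqnn _)).
    apply: eq_fglift_dom => w /shuffle_fuel_bound wl.
    rewrite fglift_xmon; apply: shuffle_fuel_enough => //.
    by rewrite addn1 ltnS wl.
- by rewrite addSn addnS.
- by rewrite addSn addnS.
Qed.

End Shuffle.

Arguments xmon {p} w.
Arguments shuffle {p} r x y.

Section HasseSchmidt.
Variables (p : nat) (F : finFieldType).
Local Notation r := #|F|.
Local Notation R := (shuffle_alg p).
Local Notation K := (Kinf F).

(* The binomial coefficient z (z - 1) ... (z - n + 1) / n!; the division is
   exact. *)
Definition binz (z : int) (n : nat) : int :=
  ((\prod_(i < n) (z - i%:Z)) %/ (n`!)%:Z)%Z.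

(* The scalar c in F_p acts on K as the natural number representing it. *)
Definition Fp_linear (f : R -> K) : Prop :=
  forall (c : 'F_p) (x y : R), f (c *: x + y) = f x *+ c + f y.

Definition linear_ext (f : word -> K) (x : R) : K :=
  \sum_(w <- dom x) f w *+ (coeff w x : 'F_p).

Definition zeta_index (s : word) : seq int := [seq (val k)%:Z | k <- s].

Definition zetahat : R -> K := linear_ext (fun s => zetaA F (zeta_index s)).

(* For the empty word the sum has one term if N = 0 and none otherwise:
   D_0(1) = 1 and D_N(1) = 0 for N > 0, as for any Hasse-Schmidt derivation. *)
Definition D_word (N : nat) (s : word) : K :=
  \sum_(n : (size s).-tuple 'I_N.+1 | (\sum_(j < size s) tnth n j == N)%N)
    (\prod_(j < size s) (binz (- (zeta_index s)`_j) (tnth n j))%:~R) *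
    zetaA F [seq (zeta_index s)`_j - (tnth n j)%:Z * (r%:Z - 1)
            | j : 'I_(size s)].

Definition D_map (N : nat) : R -> K := linear_ext (D_word N).

Lemma linear_ext_xmon (f : word -> K) (s : word) :
  linear_ext f (xmon s) = f s.
Proof.
rewrite /linear_ext /xmon domU1 big_seq1 coeffU eqxx mulr1.
by rewrite [nat_of_ord _]/= mulr1n.
Qed.

Lemma D_map_nil N : D_map N (xmon [::]) = (N == 0%N)%:R.
Proof.
rewrite /D_map linear_ext_xmon /D_word /=; case: N => [|N].
  rewrite (bigD1 [tuple]) /= ?big_ord0 // mul1r big1 ?addr0; last first.
    by move=> t /andP[_ /eqP[]]; rewrite (tuple0 t).
  rewrite -[RHS](zetaA_nil F); congr zetaA; apply/size0nil.
  by rewrite size_map -cardE card_ord.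
by rewrite big_pred0 // => t; rewrite big_ord0.
Qed.

Definition Fp_algebra_morphism (f : R -> K) : Prop :=
  [/\ Fp_linear f, f (xmon [::]) = 1 &
      forall x y : R, f (shuffle r x y) = f x * f y].

Definition Hasse_Schmidt (f : R -> K) (E : nat -> R -> K) : Prop :=
  [/\ Fp_algebra_morphism f, E 0%N = f, forall N, Fp_linear (E N) &
      forall N (x y : R),
        E N (shuffle r x y) = \sum_(k < N.+1) E k x * E (N - k)%N y].

End HasseSchmidt.

(* Main.v *)
(* Put psi(a) = a + a^r T, an F_r-linear map from A to the power series in T
   over K_infinity.  By the binomial series, the coefficient of T^n in psi(a)^-s
   is binom(-s, n) a^(-(s - n (r - 1))), so the coefficient of T^N in the
   multiple power sum built from the psi(a) instead of the a is D_N(x_s) with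
   the zeta values replaced by the sums S_{<d}.  The product formula of the
   r-shuffle algebra for the power sums of degree d comes from the partial
   fractions of 1 / (x^m y^n) along x - y and from summing c^-j over F_r^*; it
   uses only that psi is F_r-linear with invertible values, so it holds for the
   deformed sums.  Comparing coefficients of T^N and letting d tend to infinity
   gives the theorem. *)
From HB Require Import structures.
Require Import Defs.
From mathcomp Require Import all_boot all_order all_algebra all_field.
From mathcomp Require Import boolp classical_sets functions filter topology.
From mathcomp Require Import ring.
From mathcomp.multinomials Require Import freeg.

Set Implicit Arguments.
Unset Strict Implicit.
Unset Printing Implicit Defensive.

Import Order.TTheory GRing.Theory Num.Theory.

Local Open Scope ring_scope.

(** * Partial fractions and sums over finite fields *)

(* The value at m = 0 is the one that makes product_partial_fractions hold for
   m = 0 or n = 0 as well, where it starts the induction. *)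
Definition pf_coef (m j : nat) : nat :=
  if j is j'.+1 then (if m is m'.+1 then 'C(j', m') else 0) else (m == 0%N).

Lemma pf_coefS m j : pf_coef m.+1 j.+1 = (pf_coef m j + pf_coef m.+1 j)%N.
Proof.
case: m j => [|m] [|j] //=; first by rewrite !bin0.
by rewrite binS addnC.
Qed.

(** Replacing one factor [X * Y] by [W * (X + Y)] lowers one of the exponents at the cost of a
    factor [W], and the coefficients obey the Pascal rule [pf_coefS]. The relation models X = 1/x, Y
    = -1/y, W = 1/(x - y) without inverses. *)
Lemma product_partial_fractions (L : comNzRingType) (X Y W : L) (m n : nat) :
  X * Y = W * (X + Y) -> (0 < m + n)%N ->
  X ^+ m * Y ^+ n =
    \sum_(j < m + n) (W ^+ j * Y ^+ (m + n - j) *+ pf_coef m j +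
                      W ^+ j * X ^+ (m + n - j) *+ pf_coef n j).
Proof.
move=> XY; have [k] := ubnP (m + n); elim: k m n => // k IHk.
(* With one exponent zero only j = 0 survives, since 'C(i, q) = 0 for i < q. *)
have base q Z V : \sum_(j < q.+1) (W ^+ j * Z ^+ (q.+1 - j) *+ pf_coef 0 j +
      W ^+ j * V ^+ (q.+1 - j) *+ pf_coef q.+1 j) = Z ^+ q.+1.
  rewrite big_ord_recl /= !expr0 !mul1r addr0 big1 ?addr0 // => i _.
  by rewrite add0n bin_small // !mulr0n addr0.
case=> [|m] [|n] // mnk _; first by rewrite expr0 mul1r base.
  rewrite expr0 mulr1 addn0 -[LHS](base m X Y).
  by apply: eq_bigr => i _; rewrite addrC.
have -> : X ^+ m.+1 * Y ^+ n.+1 = W * (X ^+ m * Y ^+ n.+1 + X ^+ m.+1 * Y ^+ n).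
  rewrite (exprS X) (exprS Y) mulrACA XY -!mulrA; congr (W * _).
  by rewrite mulrDl addrC (mulrCA (X ^+ m)) !mulrA.
rewrite (IHk m n.+1) ?addnS // ?(IHk m.+1 n) ?addSn //.
- rewrite -big_split big_distrr [RHS]big_ord_recl !mulr0n !add0r.
  apply: eq_bigr => i _.
  rewrite lift0 !pf_coefS subSS /=.
  rewrite exprS !mulrnDr !mulrDr !mulrnAr !mulrA.
  by rewrite [X in _ + X]addrC addrACA [X in _ + X]addrC addrACA.
- by move: mnk; rewrite addSn !addnS !ltnS.
by move: mnk; rewrite addSn !addnS !ltnS.
Qed.

Section FiniteFieldSums.
Variable F : finFieldType.
Local Notation r := #|F|.

Lemma finField_gt1 : (1 < r)%N.
Proof. exact: finNzRing_gt1. Qed.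

(** Translation by 1 permutes F, so the sum of all elements equals itself plus r. *)
Lemma natr_card_finField : r%:R = 0 :> F.
Proof.
have sumE : \sum_(c : F) c = r%:R + \sum_(c : F) c.
  rewrite [LHS](reindex_inj (addrI (1 : F))) big_split /=.
  by congr (_ + _); rewrite -sumr_const; apply: eq_bigl.
by apply: (addIr (\sum_(c : F) c)); rewrite add0r -sumE.
Qed.

(** If r - 1 divides j, all r - 1 terms are 1. Otherwise reindexing by some c with c^j different
    from 1 shows the sum equal to c^-j times itself, hence zero. *)
Lemma sum_finField_expr (j : nat) :
  \sum_(c : F | c != 0) c ^- j = if (r - 1 %| j)%N then -1 else 0.
Proof.
have pow1 (c : F) : c != 0 -> c ^+ (r - 1) = 1.
  move=> c0; apply: (mulfI c0); rewrite mulr1 -exprS subn1.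
  by rewrite prednK ?expf_card // ltnW ?finField_gt1.
have card_neq0 : #|[pred c : F | c != 0]| = (r - 1)%N.
  have := cardC1 (0 : F); rewrite -subn1 => <-.
  by apply: eq_card => c; rewrite !inE.
have rF0 := natr_card_finField.
case: ifP => [/dvdnP[q ->]|ndvd].
  rewrite (eq_bigr (fun=> 1)); last first.
    by move=> c c0; rewrite mulnC exprM pow1 // expr1n invr1.
  have -> : \sum_(c : F | c != 0) 1 = (r - 1)%:R :> F.
    by rewrite -card_neq0 -sumr_const; apply: eq_bigl => c; rewrite inE.
  have r1 := @finField_gt1; rewrite natrB ?(ltnW r1) //.
  by rewrite [X in X - _]rF0 sub0r.
(* If c^j = 1 for every nonzero c, then X^(j mod (r - 1)) - 1 would be a nonzero polynomial of
   degree below r - 1 with r - 1 roots. *)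
have [c c0 cj] : exists2 c : F, c != 0 & c ^+ j != 1.
  apply/exists_inP; apply: contraFT ndvd; rewrite negb_exists_in.
  move/forall_inP => all1; rewrite /dvdn; apply/negPn/negP => jn0.
  have jlt : (j %% (r - 1) < r - 1)%N by rewrite ltn_mod subn_gt0 finField_gt1.
  have := @max_poly_roots F ('X^(j %% (r - 1)) - 1)
    (enum [pred c : F | c != 0]).
  rewrite -polyC1 -size_poly_eq0 size_XnsubC ?lt0n // => /(_ isT).
  rewrite enum_uniq -cardE card_neq0 => H.
  have /H/(_ isT) : all (root ('X^(j %% (r - 1)) - 1%:P))
      (enum [pred c : F | c != 0]).
    apply/allP => c; rewrite mem_enum inE => c0.
    rewrite rootE !hornerE subr_eq0.
    have := all1 c c0; rewrite negbK {1}(divn_eq j (r - 1)) exprD mulnC exprM.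
    by rewrite pow1 // expr1n mul1r.
  by rewrite ltnS leqNgt jlt.
have : \sum_(c' : F | c' != 0) c' ^- j =
       c ^- j * \sum_(c' : F | c' != 0) c' ^- j.
  rewrite big_distrr /= (reindex_inj (mulfI c0)) /=.
  apply: eq_big => [c'|c' _]; first by rewrite mulf_eq0 negb_or c0.
  by rewrite exprMn invfM.
move/eqP; rewrite -subr_eq0 -{1}[\sum_(_ | _) _]mul1r -mulrBl mulf_eq0.
case/orP=> [|/eqP//]; rewrite subr_eq0 eq_sym invr_eq1 => /eqP cj1.
by rewrite cj1 eqxx in cj.
Qed.

Lemma big_npolyS (V : nmodType) (d : nat) (f : {poly F} -> V) :
  \sum_(h : {poly_d.+1 F}) f h =
  \sum_(c : F) \sum_(b : {poly_d F}) f (c *: 'X^d + b).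
Proof.
rewrite pair_bigA /=.
pose g (cb : F * {poly_d F}) : {poly_d.+1 F} :=
  npolyp d.+1 (cb.1 *: 'X^d + (cb.2 : {poly F})).
have gE cb : g cb = cb.1 *: 'X^d + (cb.2 : {poly F}) :> {poly F}.
  apply: npolypK; rewrite (leq_trans (size_polyD _ _)) // geq_max.
  rewrite (leq_trans (size_scale_leq _ _)) ?size_polyXn //.
  by rewrite (leq_trans (size_npoly _)).
rewrite (reindex g); last first.
  exists (fun h : {poly_d.+1 F} => (h`_d, npolyp d (h : {poly F})))
      => [[c b] _|h _].
    have gd : (g (c, b))`_d = c.
      by rewrite gE coefD coefZ coefXn eqxx mulr1 big_coef_npoly ?addr0.
    congr (_, _); first exact: gd.
    apply/npolyP => i; rewrite coef_npolyp gE coefD coefZ coefXn.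
    case: ltnP => [id|di]; first by rewrite ltn_eqF // mulr0 add0r.
    by rewrite big_coef_npoly.
  apply/npolyP => i; rewrite gE coefD coefZ coefXn coef_npolyp.
  case: ltngtP => [id|di|->]; rewrite ?mulr0 ?add0r ?mulr1 ?addr0 //.
  by rewrite big_coef_npoly.
by apply: eq_bigr => cb _; rewrite gE.
Qed.

Lemma monomial_npoly_neq0 (d : nat) (c : F) (b : {poly_d F}) :
  c != 0 -> c *: 'X^d + b != 0 :> {poly F}.
Proof.
apply: contra => /eqP/(congr1 (fun q : {poly F} => q`_d)).
rewrite coefD coefZ coefXn eqxx mulr1 coef0 big_coef_npoly // addr0.
by move/eqP.
Qed.

(** Monic sums become sums over a whole vector space, where translations and scalings are
    reindexings. *)
Lemma big_monic (V : nmodType) (d : nat) (f : {poly F} -> V) :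
  \sum_(a : {poly_d.+1 F} | ((a : {poly F}) \is monic) && (size a == d.+1))
     f a =
  \sum_(b : {poly_d F}) f ('X^d + b).
Proof.
rewrite big_mkcond /=.
rewrite (big_npolyS d
  (fun a => if (a \is monic) && (size a == d.+1) then f a else 0)).
have sz c (b : {poly_d F}) : c != 0 -> size (c *: 'X^d + b : {poly F}) = d.+1.
  move=> c0; rewrite size_polyDl size_scale ?size_polyXn // ltnS.
  exact: size_npoly.
have lc c (b : {poly_d F}) : (c *: 'X^d + b : {poly F})`_d = c.
  by rewrite coefD coefZ coefXn eqxx mulr1 big_coef_npoly ?addr0.
rewrite (bigD1 1) //= [X in _ + X]big1 ?addr0; last first.
  move=> c c1; rewrite big1 // => b _; case: ifP => // /andP[].
  rewrite monicE lead_coefE => /[swap]/eqP-> /=; rewrite lc => c1'.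
  by rewrite c1' in c1.
apply: eq_bigr => b _.
by rewrite monicE lead_coefE sz ?oner_neq0 // [_.-1]/= lc !eqxx scale1r.
Qed.

(** This makes S_d(s) vanish for s <= 0 and large d. In the expansion along the top term
    [c *: 'X^d], its positive powers leave a smaller exponent, handled by induction; its zeroth
    power does not depend on c and is counted r times. *)
Lemma sum_npoly_expr_eq0 (x : {poly F}) (d k : nat) : (k < d)%N ->
  \sum_(b : {poly_d F}) (x + b) ^+ k = 0.
Proof.
elim: d k => // d IHd k kd; rewrite (big_npolyS d (fun b => (x + b) ^+ k)).
transitivity (\sum_(i < k.+1) \sum_(c : F)
    (\sum_(b : {poly_d F}) (x + b) ^+ (k - i)) * (c *: 'X^d) ^+ i *+ 'C(k, i)).
  rewrite [RHS]exchange_big /=; apply: eq_bigr => c _.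
  under [RHS]eq_bigr do rewrite big_distrl -sumrMnl /=.
  rewrite [RHS]exchange_big /=; apply: eq_bigr => b _.
  by rewrite addrCA addrC exprDn.
rewrite big_ord_recl [X in _ + X]big1 ?addr0 => [|i _]; last first.
  apply: big1 => c _.
  rewrite lift0 IHd ?mul0r ?mul0rn // (leq_trans _ (kd : (k <= d)%N)) //.
  by rewrite ltn_subrL /= (leq_ltn_trans _ (ltn_ord i)).
rewrite /= subn0 bin0; set y := \sum_(b : {poly_d F}) _.
have -> : \sum_(c : F) y * (c *: 'X^d) ^+ 0 *+ 1 = y *+ r.
  rewrite -sumr_const; apply: eq_big => // c _.
  by rewrite expr0 mulr1.
by rewrite -mulr_natr -(rmorph_nat (@polyC F)) natr_card_finField mulr0.
Qed.

End FiniteFieldSums.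

(** [product_partial_fractions] at X = 1/x, Y = -1/y, W = 1/(x - y). Writing y - x in the first half
    absorbs the dependence of the sign on j, so that swapping (x, m) with (y, n) exchanges the
    halves. *)
Lemma inverse_product_partial_fractions (L : comUnitRingType) (x y : L)
    (m n : nat) :
  x \is a GRing.unit -> y \is a GRing.unit -> x - y \is a GRing.unit ->
  (0 < m + n)%N ->
  x ^- m * y ^- n =
    \sum_(j < m + n)
      (((y - x) ^- j * y ^- (m + n - j)) * ((-1) ^+ m *+ pf_coef m j) +
       ((x - y) ^- j * x ^- (m + n - j)) * ((-1) ^+ n *+ pf_coef n j)).
Proof.
move=> xU yU xyU mn_gt0.
have XY : x^-1 * - y^-1 = (x - y)^-1 * (x^-1 + - y^-1).
  apply: (mulrI xyU); rewrite mulVKr // !mulrN mulrBl.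
  by rewrite mulVKr // mulrCA divrr // mulr1 opprB.
have -> : x ^- m * y ^- n = (-1) ^+ n * (x^-1 ^+ m * (- y^-1) ^+ n).
  rewrite (exprNn y^-1) (mulrCA (_ ^+ m)) !mulrA.
  rewrite -expr2 sqrr_sign mul1r.
  by rewrite !exprVn.
rewrite (product_partial_fractions XY mn_gt0) big_distrr /=.
apply: eq_bigr => j _; rewrite mulrDr; congr (_ + _).
  rewrite !mulrnAr; congr (_ *+ _).
  rewrite -(opprB x y) (exprNn (x - y)) (exprNn y^-1) !exprVn.
  rewrite invrM ?unitrX ?unitrN1 // -[((-1) ^+ j)^-1]exprVn invrN1.
  rewrite (mulrC _ ((-1) ^+ m)) !mulrA; congr (_ * _).
  rewrite mulrAC [RHS]mulrAC; congr (_ * _).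
  rewrite -!exprD -signr_odd -[RHS]signr_odd !oddD.
  by rewrite oddB ?(ltnW (ltn_ord _)) // oddD; do 3!case: odd.
by rewrite !exprVn !mulrnAr mulrC.
Qed.

(** * Products of power sums built from an F-linear map *)

Section LinearPowerSums.
Variables (F : finFieldType) (L : comUnitRingType) (iota : {rmorphism F -> L}).
Variable psi : {poly F} -> L.
Hypothesis psiB : {morph psi : a b / a - b}.
Hypothesis psiZ : forall c a, psi (c *: a) = iota c * psi a.
Hypothesis psiU : forall a, a != 0 -> psi a \is a GRing.unit.
Local Notation r := #|F|.

Definition psum (d s : nat) : L := \sum_(b : {poly_d F}) psi ('X^d + b) ^- s.

Lemma psum_base_unit d (b : {poly_d F}) : psi ('X^d + b) \is a GRing.unit.
Proof.
by apply: psiU; rewrite -[X in X + _]scale1r monomial_npoly_neq0 ?oner_neq0.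
Qed.

(** A nonzero h is uniquely c times a monic polynomial of degree e < d, and the factors c^-j are
    summed by [sum_finField_expr]. *)
Lemma sum_nonzero_inverse_powers (d j : nat) :
  \sum_(h : {poly_d F} | h != 0) psi h ^- j =
  (if (r - 1 %| j)%N then -1 else 0) * \sum_(e < d) psum e j.
Proof.
elim: d => [|d IHd].
  rewrite big_ord0 mulr0 big_pred0 // => h; apply/negbTE; rewrite negbK.
  by rewrite -val_eqE -size_poly_leq0; exact: size_npoly.
rewrite big_ord_recr mulrDr -IHd big_mkcond /=.
rewrite (big_npolyS d (fun a => if a != 0 then psi a ^- j else 0)).
rewrite (bigD1 0) //=; congr (_ + _).
  rewrite [RHS]big_mkcond /=; apply: eq_bigr => b _.
  by rewrite scale0r add0r -val_eqE.
have -> : (if (r - 1 %| j)%N then -1 else 0) =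
    \sum_(c : F | c != 0) iota c ^- j.
  have -> : (if (r - 1 %| j)%N then -1 else 0) =
      iota (if (r - 1 %| j)%N then -1 else 0).
    by case: ifP; rewrite ?rmorphN1 ?rmorph0.
  rewrite -sum_finField_expr rmorph_sum; apply: eq_bigr => c _.
  by rewrite fmorphV rmorphXn.
rewrite big_distrl /=; apply: eq_bigr => c c0.
have cU : iota c \is a GRing.unit by rewrite rmorph_unit ?unitfE.
rewrite big_distrr (reindex_inj (scalerI c0)) /=; apply: eq_bigr => b _.
rewrite (monomial_npoly_neq0 (c *: b)) // -scalerDr psiZ exprMn.
by rewrite invrM ?unitrX ?psum_base_unit // mulrC.
Qed.

(** Whatever b is, h = b - b' runs over all nonzero polynomials of degree below d, so the double sum
    factors. *)
Lemma sum_pairs_differences (d i j : nat) :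
  \sum_(b : {poly_d F}) \sum_(b' : {poly_d F} | b' != b)
     psi (b - b') ^- j * psi ('X^d + b) ^- i =
  psum d i * \sum_(h : {poly_d F} | h != 0) psi h ^- j.
Proof.
rewrite /psum big_distrl /=; apply: eq_bigr => b _.
rewrite big_distrr /= (reindex_inj (subrI b)) /=.
apply: eq_big => [h|h _].
  by rewrite -subr_eq0 addrAC subrr sub0r oppr_eq0.
by rewrite opprB addrC subrK mulrC.
Qed.

(** Diagonal pairs b = b' give the first term. The other pairs are split by partial fractions along
    the difference of the two values, which is psi(b - b') because X^d cancels; this is where sums
    of lower degree e < d enter. *)
Lemma psum_mul (d m n : nat) : (0 < m)%N -> (0 < n)%N ->
  psum d m * psum d n = psum d (m + n) +
    \sum_(1 <= j < m + n)
      (if (r - 1 %| j)%N then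
         (-1) ^+ (m - 1) *+ 'C(j - 1, m - 1) +
         (-1) ^+ (n - 1) *+ 'C(j - 1, n - 1)
       else 0) * (psum d (m + n - j) * \sum_(e < d) psum e j).
Proof.
move=> m0 n0; rewrite {1 2}/psum big_distrlr /=.
under eq_bigr => b _ do rewrite (bigD1 b) //=.
rewrite big_split /=; congr (_ + _).
  apply: eq_bigr => b _.
  by rewrite -invrM ?unitrX ?psum_base_unit // -exprD addnC.
have pf (b b' : {poly_d F}) : b' != b ->
    psi ('X^d + b) ^- m * psi ('X^d + b') ^- n =
    \sum_(j < m + n)
      ((psi (b' - b) ^- j * psi ('X^d + b') ^- (m + n - j)) *
         ((-1) ^+ m *+ pf_coef m j) +
       (psi (b - b') ^- j * psi ('X^d + b) ^- (m + n - j)) *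
         ((-1) ^+ n *+ pf_coef n j)).
  have psiD (c c' : {poly_d F}) :
      psi (c - c') = psi ('X^d + c) - psi ('X^d + c').
    by rewrite -psiB opprD addrACA subrr add0r.
  move=> b'b; rewrite inverse_product_partial_fractions ?psum_base_unit //.
  - by apply: eq_bigr => j _; rewrite !psiD.
  - by rewrite -psiD psiU // subr_eq0 val_eqE eq_sym.
  - by rewrite addn_gt0 m0.
under eq_bigr => b _ do under eq_bigr => b' b'b do rewrite pf //.
under eq_bigr => b _ do rewrite exchange_big /=.
rewrite exchange_big /= -(big_mkord xpredT (fun j => \sum_(b : {poly_d F})
  \sum_(b' : {poly_d F} | b' != b)
      ((psi (b' - b) ^- j * psi ('X^d + b') ^- (m + n - j)) *
         ((-1) ^+ m *+ pf_coef m j) +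
       (psi (b - b') ^- j * psi ('X^d + b) ^- (m + n - j)) *
         ((-1) ^+ n *+ pf_coef n j)))).
(* Both coefficients at j = 0 vanish because m and n are positive. *)
rewrite big_ltn ?addn_gt0 ?m0 // [X in X + _]big1 ?add0r; last first.
  move=> b _; rewrite big1 // => b' _.
  case: m m0 {pf} => // m _; case: n n0 => // n _.
  by rewrite !mulr0n !mulr0 addr0.
apply: eq_big_nat => j /andP[j0 _].
set k := (m + n - j)%N.
transitivity (
    (\sum_(b : {poly_d F}) \sum_(b' : {poly_d F} | b' != b)
       psi (b' - b) ^- j * psi ('X^d + b') ^- k) * ((-1) ^+ m *+ pf_coef m j) +
    (\sum_(b : {poly_d F}) \sum_(b' : {poly_d F} | b' != b)
       psi (b - b') ^- j * psi ('X^d + b) ^- k) * ((-1) ^+ n *+ pf_coef n j)).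
  rewrite !big_distrl -big_split /=; apply: eq_bigr => b _.
  by rewrite !big_distrl -big_split.
(* Exchanging b and b' in the first half brings both halves to the shape of
   [sum_pairs_differences]. *)
rewrite (exchange_big_dep xpredT) //=.
under eq_bigr => b _ do under eq_bigl => b' do rewrite eq_sym.
rewrite !sum_pairs_differences sum_nonzero_inverse_powers -mulrDr.
clearbody k; case: j j0 => // j _.
case: m m0 {pf} => // m _; case: n n0 => // n _.
rewrite !subSS !subn0 /= [RHS]mulrC -mulrA -[RHS]mulrA.
congr (_ * _); rewrite mulrAC [LHS]mulrC; congr (_ * _).
case: ifP => _; last by rewrite mul0r.
(* The -1 from the sum over nonzero scalars turns (-1)^m into (-1)^(m - 1), and likewise for n. *)
by rewrite mulN1r opprD !exprS !mulN1r !mulNrn !opprK.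
Qed.

End LinearPowerSums.

(** * The shuffle product of multiple sums *)

Section MulrnFp.
Variables (p : nat) (V : zmodType).
Hypothesis p_prime : prime p.
Hypothesis pV : forall v : V, v *+ p = 0.
Implicit Types (v : V) (a b : 'F_p).

Lemma mulrn_Fp_nat v n : v *+ (n%:R : 'F_p) = v *+ n.
Proof.
by rewrite val_Fp_nat // [in RHS](divn_eq n p) mulrnDr mulrnA pV add0r.
Qed.

Lemma mulrn_FpD v a b : v *+ (a + b)%R = v *+ a + v *+ b.
Proof.
by rewrite -{1}(natr_Zp a) -{1}(natr_Zp b) -natrD mulrn_Fp_nat mulrnDr.
Qed.

Lemma mulrn_FpM v a b : v *+ (a * b)%R = v *+ b *+ a.
Proof.
by rewrite -{1}(natr_Zp a) -{1}(natr_Zp b) -natrM mulrn_Fp_nat mulnC mulrnA.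
Qed.

Lemma mulrn_FpN v a : v *+ (- a)%R = - (v *+ a).
Proof. by apply: (addIr (v *+ a)); rewrite -mulrn_FpD !addNr. Qed.


End MulrnFp.

Section WordLinear.
Variables (p : nat) (V : zmodType).
Hypothesis p_prime : prime p.
Hypothesis pV : forall v : V, v *+ p = 0.
Local Notation R := (shuffle_alg p).
Implicit Types (f : word -> V) (x y : R).

(** [linear_ext] with an arbitrary target, since values in [pseries K] are needed. *)
Definition wlin f x : V := \sum_(w <- dom x) f w *+ (coeff w x : 'F_p).

(** A common list allows termwise comparison of x, y and their combinations, whose domains
    differ. *)
Lemma wlin_supset f x (s : seq word) :
  uniq s -> {subset dom x <= s} ->
  wlin f x = \sum_(w <- s) f w *+ (coeff w x : 'F_p).
Proof.
move=> s_uniq dom_s; rewrite [RHS](bigID (mem (dom x))) /=.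
rewrite [X in _ + X]big1 ?addr0; last by move=> w /coeff_outdom ->.
rewrite -big_filter; apply: perm_big; apply: uniq_perm.
- exact: uniq_dom.
- exact: filter_uniq.
by move=> w; rewrite mem_filter /= andb_idr // => /dom_s.
Qed.

Lemma wlin_linear f (c : 'F_p) x y :
  wlin f (c *: x + y) = wlin f x *+ c + wlin f y.
Proof.
pose s := undup (dom x ++ dom y).
have s_uniq : uniq s by apply: undup_uniq.
have xs : {subset dom x <= s} by move=> w wx; rewrite mem_undup mem_cat wx.
have ys : {subset dom y <= s} by move=> w wy; rewrite mem_undup mem_cat wy orbT.
have xys : {subset dom (c *: x + y : R) <= s}.
  by move=> w /domD_subset; rewrite mem_cat => /orP[/domZ_subset/xs|/ys].
rewrite (wlin_supset f s_uniq xs) (wlin_supset f s_uniq ys).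
rewrite (wlin_supset f s_uniq xys) -sumrMnl -big_split /=.
by apply: eq_bigr => w _; rewrite coeffD coeffZ mulrn_FpD // mulrn_FpM.
Qed.

Lemma wlin0 f : wlin f 0 = 0.
Proof. by rewrite /wlin dom0 big_nil. Qed.

Lemma wlinD f x y : wlin f (x + y) = wlin f x + wlin f y.
Proof. by rewrite -[x in LHS]scale1r wlin_linear. Qed.

Lemma wlinZ f c x : wlin f (c *: x) = wlin f x *+ c.
Proof. by rewrite -[_ *: x]addr0 wlin_linear wlin0 addr0. Qed.

Lemma wlin_sum f (I : Type) (s : seq I) (P : pred I) (g : I -> R) :
  wlin f (\sum_(i <- s | P i) g i) = \sum_(i <- s | P i) wlin f (g i).
Proof. exact: (big_morph _ (wlinD f) (wlin0 f)). Qed.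

Lemma wlin_xmon f w : wlin f (xmon w) = f w.
Proof.
rewrite /wlin /xmon domU1 big_seq1 coeffU eqxx mulr1.
by rewrite -[RHS]mulr1n -(mulrn_Fp_nat p_prime pV _ 1).
Qed.

Lemma wlin_fglift f (g : word -> R) x :
  wlin f (fglift g x) = wlin (fun w => wlin f (g w)) x.
Proof.
by rewrite fglift_dom wlin_sum; apply: eq_bigr => w _; rewrite wlinZ.
Qed.

Lemma wlin_lconcat f k x : wlin f (lconcat k x) = wlin (fun w => f (k :: w)) x.
Proof. by rewrite wlin_fglift; apply: eq_bigr => w _; rewrite wlin_xmon. Qed.

End WordLinear.

Section StuffleSums.
Variables (p r : nat) (L : comNzRingType) (T : nat -> nat -> L).
Hypothesis p_prime : prime p.
Hypothesis pL : forall x : L, x *+ p = 0.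
Hypothesis T_mul : forall d m n, (0 < m)%N -> (0 < n)%N ->
  T d m * T d n = T d (m + n) +
    \sum_(1 <= j < m + n)
      (if (r - 1 %| j)%N then
         (-1) ^+ (m - 1) *+ 'C(j - 1, m - 1) +
         (-1) ^+ (n - 1) *+ 'C(j - 1, n - 1)
       else 0) * (T d (m + n - j) * \sum_(e < d) T e j).

(** The analogue of S_{<d} with T in place of the power sums, by recursion on the leading index. *)
Fixpoint msum (d : nat) (w : word) : L :=
  if w is a :: w' then \sum_(e < d) T e (val a) * msum e w' else 1.

Lemma msum_cons d a w :
  msum d (a :: w) = \sum_(e < d) T e (val a) * msum e w.
Proof. by []. Qed.

Arguments msum : simpl never.

Lemma mulrn_Delta (x : L) m n j :
  x *+ Delta p r m n j =
  (if (r - 1 %| j)%N then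
     (-1) ^+ (m - 1) *+ 'C(j - 1, m - 1) + (-1) ^+ (n - 1) *+ 'C(j - 1, n - 1)
   else 0) * x.
Proof.
have signE k l : x *+ ((-1) ^+ k * l%:R : 'F_p)%R = (-1) ^+ k *+ l * x.
  rewrite -[in LHS]signr_odd -[in RHS]signr_odd; case: odd.
    rewrite !expr1 mulN1r mulrn_FpN // mulrn_Fp_nat //.
    by rewrite mulNrn mulNr mulr_natl.
  by rewrite !expr0 mul1r mulrn_Fp_nat // mulr_natl.
rewrite /Delta; case: ifP => _; last by rewrite mul0r.
by rewrite mulrn_FpD // !signE mulrDl.
Qed.

Lemma val_mkletter k : (0 < k)%N -> val (mkletter k) = k.
Proof. by move=> k0; rewrite val_insubd k0. Qed.

Lemma wlin_msum_cons d k (x : shuffle_alg p) :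
  wlin (fun w => msum d (k :: w)) x =
  \sum_(e < d) T e (val k) * wlin (msum e) x.
Proof.
rewrite /wlin; under eq_bigr do rewrite msum_cons -sumrMnl.
rewrite exchange_big /=; apply: eq_bigr => e _.
by rewrite big_distrr /=; apply: eq_bigr => w _; rewrite mulrnAr.
Qed.

(** With e the larger of the two leading indices, the three terms correspond to the first being
    larger, the second being larger, and both being equal. *)
Lemma msum_mul_cons d (a b : letter) u v :
  msum d (a :: u) * msum d (b :: v) =
  \sum_(e < d) (T e (val a) * (msum e u * msum e (b :: v)) +
    T e (val b) * (msum e (a :: u) * msum e v) +
    T e (val a) * T e (val b) * (msum e u * msum e v)).
Proof.
elim: d => [|d IHd]; first by rewrite !msum_cons !big_ord0 mul0r.
rewrite big_ord_recr -IHd.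
have rec c w : msum d.+1 (c :: w) = msum d (c :: w) + T d (val c) * msum d w.
  by rewrite !msum_cons big_ord_recr.
rewrite !rec mulrDl !mulrDr; set A := msum d (a :: u); set B := msum d (b :: v).
rewrite -!addrA; congr (_ + _); rewrite addrCA; congr (_ + _).
  by rewrite mulrCA.
by congr (_ + _); [rewrite mulrA | rewrite mulrACA].
Qed.

Lemma wlin_msum_shuffle_fuel n u v d : (size u + size v <= n)%N ->
  wlin (msum d) (shuffle_fuel p r n u v) = msum d u * msum d v.
Proof.
elim: n u v d => [|n IHn] [|a u] [|b v] d //=;
  rewrite ?wlin_xmon //= ?mul1r ?mulr1 //.
rewrite addSn addnS !ltnS => uvn.
rewrite msum_mul_cons.
rewrite !wlinD // wlin_sum // !wlin_lconcat // !wlin_msum_cons.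
under [X in _ + X = _]eq_bigr => j _
  do rewrite wlinZ // wlin_lconcat // wlin_msum_cons -sumrMnl.
rewrite exchange_big /= -!big_split /=; apply: eq_bigr => e _.
(* The first two terms agree by induction; there remains the diagonal product, which [T_mul]
   expands. *)
rewrite !IHn ?addSn ?addnS ?(ltnW uvn) // -!addrA; congr (_ + (_ + _)).
have a0 := valP a; have b0 := valP b.
rewrite T_mul // mulrDl val_mkletter ?addn_gt0 ?a0 //; congr (_ + _).
rewrite big_distrl /=; apply: eq_big_nat => j /andP[j0 jab].
rewrite mulrn_Delta -mulrA; congr (_ * _).
rewrite val_mkletter ?subn_gt0 // -mulrA; congr (_ * _).
(* The inner sum of the T-values at j is [msum] of the one-letter word x_j, so induction applies to
   x_j and each word w of the product of u and v, whose depth is at most that of u and v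
   together. *)
rewrite wlin_fglift // -[X in _ * X]IHn ?(ltnW uvn) // mulrC.
rewrite /wlin big_distrl /= big_seq [RHS]big_seq; apply: eq_bigr => w wuv.
rewrite -/(wlin _ _) mulrnAl IHn /= ?msum_cons ?val_mkletter //.
  by congr (_ * _ *+ _); apply: eq_bigr => i _; rewrite mulr1.
by rewrite addn1 (leq_ltn_trans (shuffle_fuel_bound wuv)).
Qed.

Lemma wlin_msum_shuffle d (x y : shuffle_alg p) :
  wlin (msum d) (shuffle r x y) = wlin (msum d) x * wlin (msum d) y.
Proof.
rewrite /shuffle wlin_fglift // [in RHS]/wlin big_distrl /=.
apply: eq_bigr => u _; rewrite wlin_fglift // mulrnAl; congr (_ *+ _).
rewrite big_distrr /=; apply: eq_bigr => v _.
by rewrite wlin_msum_shuffle_fuel // mulrnAr.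
Qed.

End StuffleSums.

(** * The deformed power sums *)

(** At s = n = 0 the truncated predecessor is 0 and the binomial is 1, as required. *)
Lemma prod_opp_shift (s n : nat) :
  \prod_(i < n) (- s%:Z - i%:Z) = (-1) ^+ n * ('C((s + n).-1, n) * n`!)%N%:Z.
Proof.
elim: n => [|n IHn]; first by rewrite big_ord0 bin0.
rewrite big_ord_recr /= {}IHn addnS /= factS mulnA [('C(_, _) * n.+1)%N]mulnC.
rewrite -mul_bin_diag -opprD -PoszD exprS !PoszM mulrN !mulN1r mulNr.
by congr (- _); rewrite -!mulrA; congr (_ * _); rewrite mulrA mulrC.
Qed.

Lemma binz_oppn (s n : nat) :
  binz (- s%:Z) n = (-1) ^+ n * 'C((s + n).-1, n)%:Z.
Proof.
rewrite /binz prod_opp_shift PoszM mulrA mulzK //.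
by rewrite -lt0n fact_gt0.
Qed.

(** The Pascal rule at upper index -s, which drives the induction in [pcoef_deform_inv]. *)
Lemma binz_oppS (s n : nat) :
  binz (- s.+1%:Z) n.+1 + binz (- s.+1%:Z) n = binz (- s%:Z) n.+1.
Proof.
rewrite !binz_oppn !addSn !addnS /= binS PoszD mulrDr -addrA.
by rewrite [X in _ + X](_ : _ = 0) ?addr0 // exprS mulN1r mulNr addNr.
Qed.

Lemma binz0r z : binz z 0 = 1.
Proof. by rewrite /binz big_ord0. Qed.

Lemma binz0S n : binz 0 n.+1 = 0.
Proof. by rewrite -[0]oppr0 (binz_oppn 0) add0n bin_small // mulr0. Qed.

(** * Constants, and the embedding of F[theta] into K_infinity *)

Section PseriesConst.
Variable F : fieldType.

Fact pconst_is_zmod_morphism : zmod_morphism (@pconst F).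
Proof. by move=> a b; apply: pseriesP => n /=; case: eqP; rewrite ?subr0. Qed.

HB.instance Definition _ :=
  GRing.isZmodMorphism.Build F (pseries F) (@pconst F) pconst_is_zmod_morphism.

Lemma pcoef_pconstM c (f : pseries F) n :
  pcoef (pconst c * f) n = c * pcoef f n.
Proof.
by rewrite /= big_ord_recl /= subn0 big1 ?addr0 // => i _; rewrite mul0r.
Qed.

Fact pconst_is_monoid_morphism : monoid_morphism (@pconst F).
Proof.
split=> // a b; apply: pseriesP => n; rewrite pcoef_pconstM /=.
by case: eqP; rewrite ?mulr0.
Qed.

HB.instance Definition _ :=
  GRing.isMonoidMorphism.Build F (pseries F) (@pconst F)
    pconst_is_monoid_morphism.

HB.instance Definition _ := GRing.RMorphism.copy (@of_pseries F) (@tofrac _).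

Lemma pcoef_sum n (I : Type) (s : seq I) (P : pred I) (f : I -> pseries F) :
  pcoef (\sum_(i <- s | P i) f i) n = \sum_(i <- s | P i) pcoef (f i) n.
Proof.
by apply: (big_morph (fun g : pseries F => pcoef g n)) => //=; case: eqP.
Qed.

Lemma pcoefMn n (f : pseries F) k : pcoef (f *+ k) n = pcoef f n *+ k.
Proof.
by elim: k => [|k IHk]; rewrite ?mulr0n ?mulrS /= ?if_same ?IHk //.
Qed.

Lemma pvar_neq0 : of_pseries (pvar F) != 0.
Proof.
rewrite of_pseries_eq0; apply/eqP => /(congr1 (fun f => pcoef f 1)) /eqP.
by rewrite /= oner_eq0.
Qed.

Lemma theta_neq0 : theta F != 0.
Proof. by rewrite invr_eq0 pvar_neq0. Qed.

Lemma of_polyE (a : {poly F}) :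
  of_poly a = (map_poly (@of_pseries F \o @pconst F) a).[theta F].
Proof. by []. Qed.

Lemma of_polyB : {morph @of_poly F : a b / a - b}.
Proof. by move=> a b; rewrite !of_polyE rmorphB !hornerE. Qed.

Lemma of_polyZ (c : F) a : of_poly (c *: a) = of_pseries (pconst c) * of_poly a.
Proof. by rewrite !of_polyE map_polyZ !hornerE. Qed.

HB.instance Definition _ :=
  GRing.isZmodMorphism.Build {poly F} (Kinf F) (@of_poly F) of_polyB.

Lemma of_polyXn n : of_poly 'X^n = theta F ^+ n.
Proof. by rewrite of_polyE map_polyXn !hornerE. Qed.

Lemma of_poly1 : of_poly 1 = 1 :> Kinf F.
Proof. exact: (of_polyXn 0). Qed.

Lemma of_poly_int z : of_poly z%:~R = z%:~R :> Kinf F.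
Proof. by rewrite raddfMz /= of_poly1. Qed.

(* Since theta is the inverse of the uniformizer, an element of degree d is
   theta^d times the power series with the reversed coefficients. *)
Lemma of_poly_expansion (a : {poly F}) d : (size a <= d.+1)%N ->
  of_poly a =
  theta F ^+ d *
  of_pseries (PSeries (fun n => if (n <= d)%N then a`_(d - n) else 0)).
Proof.
move=> ad; rewrite of_polyE (horner_coef_wide _ (n := d.+1)); last first.
  by rewrite (leq_trans (size_poly _ _)).
have -> : PSeries (fun n => if (n <= d)%N then a`_(d - n) else 0) =
    \sum_(i < d.+1) pconst a`_i * pvar F ^+ (d - i).
  apply: pseriesP => n; rewrite pcoef_sum.
  under eq_bigr => i _ do rewrite pcoef_pconstM pvarXn_coef.
  rewrite /=; case: leqP => [nd|dn].
    have dn : (d - n < d.+1)%N by rewrite ltnS leq_subr.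
    rewrite (bigD1 (Ordinal dn)) //= subKn // eqxx mulr1 big1 ?addr0 // => i.
    rewrite -val_eqE /= => idn; have [nE|_] := eqVneq n (d - i)%N.
      by rewrite nE subKn ?eqxx // -ltnS in idn.
    by rewrite mulr0.
  rewrite big1 // => i _; rewrite gtn_eqF ?mulr0 //.
  by rewrite (leq_ltn_trans _ dn) ?leq_subr.
rewrite rmorph_sum big_distrr /=; apply: eq_bigr => i _.
rewrite coef_map /= rmorphM rmorphXn mulrCA; congr (_ * _).
have id : (i <= d)%N by rewrite -ltnS.
have -> : theta F ^+ d = theta F ^+ i * theta F ^+ (d - i).
  by rewrite -exprD subnKC.
by rewrite -mulrA -exprMn mulVf ?pvar_neq0 // expr1n mulr1.
Qed.

(** With d the exact degree, the reversed series has the leading coefficient as its constant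
    term. *)
Lemma of_poly_eq0 (a : {poly F}) : (of_poly a == 0) = (a == 0).
Proof.
apply/eqP/eqP => [|->]; last by rewrite of_polyE rmorph0 horner0.
move=> a0; apply/eqP; apply: contraT => an0.
have [d szd] : exists d, size a = d.+1.
  by exists (size a).-1; rewrite prednK // size_poly_gt0.
move/eqP: a0; rewrite (of_poly_expansion (d := d)) ?szd //.
rewrite mulf_eq0 expf_eq0 (negPf theta_neq0) andbF of_pseries_eq0 /=.
move/eqP => /(congr1 (fun f => pcoef f 0)) /=; rewrite subn0 => /eqP.
by rewrite -[d]/(d.+1.-1) -szd -lead_coefE lead_coef_eq0 (negPf an0).
Qed.

End PseriesConst.

Section Deformation.
Variables (p e : nat) (F : finFieldType).
Hypotheses (p_prime : prime p) (cardF : #|F| = (p ^ e)%N).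
Local Notation r := #|F|.
Local Notation K := (Kinf F).

Lemma pchar_Kinf : p \in [pchar K].
Proof.
have pF := card_finPcharP cardF p_prime.
exact: (rmorph_pchar (@of_pseries F) (rmorph_pchar (@pconst F) pF)).
Qed.

Lemma mulrn_Kinf (x : K) : x *+ p = 0.
Proof. exact: mulrn_pchar pchar_Kinf x. Qed.

Lemma mulrn_pseries_Kinf (f : pseries K) : f *+ p = 0.
Proof.
by apply: pseriesP => n; rewrite pcoefMn mulrn_Kinf /= if_same.
Qed.

(* The additive map a |-> a + a^r T, with values in power series in T over K;
   it deforms the inclusion of A in K so that a^-s acquires the coefficients
   of D_N. *)
Definition deform (a : {poly F}) : pseries K :=
  pconst (of_poly a) + pconst (of_poly a ^+ r) * pvar K.

Definition deform_scalar (c : F) : pseries K := pconst (of_pseries (pconst c)).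

HB.instance Definition _ := GRing.RMorphism.copy deform_scalar
  (@pconst K \o (@of_pseries F \o @pconst F)).

(** The r-th power is additive because r is a power of the characteristic. *)
Lemma deformB : {morph deform : a b / a - b}.
Proof.
move=> a b; rewrite /deform of_polyB rmorphB.
have -> : (of_poly a - of_poly b) ^+ r = of_poly a ^+ r - of_poly b ^+ r.
  apply: (addIr (of_poly b ^+ r)); rewrite subrK -exprDn_pchar ?subrK //.
  by rewrite (eq_pnat _ (pcharf_eq pchar_Kinf)) cardF pnatX pnat_id.
by rewrite rmorphB mulrBl opprD addrACA.
Qed.

Lemma deformZ c a : deform (c *: a) = deform_scalar c * deform a.
Proof.
rewrite /deform of_polyZ exprMn -!rmorphXn expf_card !rmorphM mulrDr.
by rewrite mulrA.
Qed.

Lemma pcoef_deform_mul (f : pseries K) a n :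
  pcoef (f * deform a) n = pcoef f n * of_poly a +
    (if n is n'.+1 then pcoef f n' * of_poly a ^+ r else 0).
Proof.
rewrite mulrC /deform mulrDl; congr (_ + _).
  by rewrite pcoef_pconstM mulrC.
rewrite -mulrA pcoef_pconstM -[pvar K]expr1 pvarXn_coefM.
by case: n => [|n]; rewrite ?mulr0 //= subSS subn0 mulrC.
Qed.

Lemma deform_unit a : a != 0 -> deform a \is a GRing.unit.
Proof.
move=> a0; change (pcoef (deform a) 0 != 0).
by rewrite -[deform a]mul1r pcoef_deform_mul addr0 mul1r of_poly_eq0.
Qed.

(** The binomial series is verified rather than derived: the candidates start at 1 and satisfy
    [g s.+1 * deform a = g s], which in each coefficient is [binz_oppS]. *)
Lemma pcoef_deform_inv (a : {poly F}) s n : a != 0 ->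
  pcoef (deform a ^- s) n =
  (binz (- s%:Z) n)%:~R * of_poly a ^ (- (s%:Z - n%:Z * (r%:Z - 1))).
Proof.
move=> a0; have x0 : of_poly a != 0 by rewrite of_poly_eq0.
pose g s : pseries K := PSeries (fun n =>
  (binz (- s%:Z) n)%:~R * of_poly a ^ (- (s%:Z - n%:Z * (r%:Z - 1)))).
suff -> : deform a ^- s = g s by [].
elim: s => [|s IHs].
  rewrite expr0 invr1; apply: pseriesP => -[|m] /=.
    by rewrite binz0r mul0r subr0 oppr0 expr0z mulr1.
  by rewrite oppr0 binz0S mul0r.
suff gS : g s.+1 * deform a = g s.
  by rewrite exprS invrM ?unitrX ?deform_unit // IHs -gS mulrK ?deform_unit.
apply: pseriesP => m; rewrite pcoef_deform_mul /= -mulrA.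
have -> : of_poly a ^ (- (s.+1%:Z - m%:Z * (r%:Z - 1))) * of_poly a =
    of_poly a ^ (- (s%:Z - m%:Z * (r%:Z - 1))).
  rewrite -[X in _ * X]expr1z -expfzDr //; congr (_ ^ _).
  by rewrite intS; ring.
case: m => [|m]; first by rewrite !binz0r addr0.
rewrite -[in RHS]binz_oppS intrD [RHS]mulrDl -mulrA; congr (_ + _ * _).
rewrite exprnP -expfzDr //; congr (_ ^ _).
by rewrite !intS; ring.
Qed.

Lemma power_sumE d z :
  power_sum F d z = \sum_(b : {poly_d F}) of_poly ('X^d + b : {poly F}) ^ (- z).
Proof. by rewrite /power_sum (big_monic d (fun a => of_poly a ^ (- z))). Qed.

Lemma pcoef_psum d s n :
  pcoef (psum deform d s) n =
  (binz (- s%:Z) n)%:~R * power_sum F d (s%:Z - n%:Z * (r%:Z - 1)).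
Proof.
rewrite power_sumE pcoef_sum big_distrr /=; apply: eq_bigr => b _.
rewrite pcoef_deform_inv // -[X in X + _]scale1r.
by rewrite monomial_npoly_neq0 ?oner_neq0.
Qed.

End Deformation.

(** * Convergence in the infinity-adic topology *)

Section InfinityAdicLimits.
Variable F : fieldType.
Local Notation K := (Kinf F).
Implicit Types (x y : K) (u v : nat -> K).

(** The elements of u^n F[[u]] with u = 1/theta; [Kball x n] is x plus these. *)
Definition small (n : nat) x : Prop :=
  exists f : pseries F, x = of_pseries f / theta F ^+ n.

Lemma smallE n (f : pseries F) :
  of_pseries f / theta F ^+ n = of_pseries (pvar F ^+ n * f).
Proof. by rewrite rmorphM rmorphXn mulrC /theta exprVn invrK. Qed.

Lemma small_pseries n (f : pseries F) :
  (forall k, (k < n)%N -> pcoef f k = 0) -> small n (of_pseries f).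
Proof.
move=> f0; exists (PSeries (fun k => pcoef f (k + n)%N)); rewrite smallE.
congr of_pseries; apply: pseriesP => k; rewrite pvarXn_coefM.
by case: ltnP => [/f0//|nk] /=; rewrite subnK.
Qed.

Lemma small_coef n (f : pseries F) k :
  small n (of_pseries f) -> (k < n)%N -> pcoef f k = 0.
Proof.
case=> g; rewrite smallE => /eqP; rewrite tofrac_eq => /eqP -> kn.
by rewrite pvarXn_coefM kn.
Qed.

Lemma small0P x : small 0 x -> exists f, x = of_pseries f.
Proof. by case=> f ->; exists f; rewrite expr0 divr1. Qed.

Lemma small0 n : small n 0.
Proof. by exists 0; rewrite rmorph0 mul0r. Qed.

Lemma smallD n x y : small n x -> small n y -> small n (x + y).
Proof. by move=> [f ->] [g ->]; exists (f + g); rewrite rmorphD mulrDl. Qed.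

Lemma smallM m n x y : small m x -> small n y -> small (m + n) (x * y).
Proof.
move=> [f ->] [g ->]; exists (f * g).
by rewrite rmorphM exprD invfM mulrACA.
Qed.

Lemma smallW m n x : (m <= n)%N -> small n x -> small m x.
Proof.
move=> mn [f ->]; rewrite smallE; apply: small_pseries => k km.
by rewrite pvarXn_coefM (leq_trans km mn).
Qed.

Lemma small_sum n (I : Type) (s : seq I) (P : pred I) (f : I -> K) :
  (forall i, P i -> small n (f i)) -> small n (\sum_(i <- s | P i) f i).
Proof. by move=> fn; elim/big_ind: _ => //; [exact: small0|exact: smallD]. Qed.

(** If x is theta^m times a power series, multiplication by x loses at most m orders, so it is
    continuous. *)
Lemma small_scale x : exists m, forall n y, small (m + n) y -> small n (x * y).
Proof.
have [m [f ->]] := laurent_expansion x; exists m => n _ [g ->]; exists (f * g).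
rewrite of_pseriesM exprD invfM (mulrC (theta F ^+ m)) (mulrCA (of_pseries g)).
by rewrite -[LHS]mulrA mulVKf ?mulrA // expf_neq0 ?theta_neq0.
Qed.

Definition tends u x : Prop :=
  forall n, exists D, forall d, (D <= d)%N -> small n (u d - x).

Lemma tends_lim u x : tends u x -> lim (u @ \oo)%classic = x.
Proof.
move=> ux; apply: cvg_lim; first exact: Kinf_hausdorff.
move=> A [n nA]; have [D uD] := ux n; exists D => // d Dd.
apply: nA; have [f fE] := uD d Dd; exists f.
by rewrite -fE addrC subrK.
Qed.

Lemma eq_tends u v x : u =1 v -> tends u x -> tends v x.
Proof.
by move=> uv ux n; have [D uD] := ux n; exists D => d /uD; rewrite uv.
Qed.

Lemma tends_cst x : tends (fun=> x) x.
Proof. by move=> n; exists 0%N => d _; rewrite subrr; apply: small0. Qed.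

Lemma tendsD u v x y :
  tends u x -> tends v y -> tends (fun d => u d + v d) (x + y).
Proof.
move=> ux vy n; have [D uD] := ux n; have [E vE] := vy n.
exists (maxn D E) => d; rewrite geq_max => /andP[/uD ud /vE vd].
by rewrite opprD addrACA; apply: smallD.
Qed.

Lemma tendsM u v x y :
  tends u x -> tends v y -> tends (fun d => u d * v d) (x * y).
Proof.
move=> ux vy n; have [m xm] := small_scale x; have [m' ym] := small_scale y.
have [D uD] := ux (m' + n)%N; have [E vE] := vy (m + n)%N.
exists (maxn D E) => d; rewrite geq_max => /andP[/uD ud /vE vd].
have -> : u d * v d - x * y =
    (u d - x) * (v d - y) + x * (v d - y) + y * (u d - x) by ring.
apply: smallD; last exact: ym.
apply: smallD; last exact: xm.
apply: smallW (smallM ud vd); by rewrite addnAC leq_addl.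
Qed.

Lemma tends_sum (I : Type) (s : seq I) (P : pred I) (u : I -> nat -> K)
    (x : I -> K) :
  (forall i, tends (u i) (x i)) ->
  tends (fun d => \sum_(i <- s | P i) u i d) (\sum_(i <- s | P i) x i).
Proof.
move=> ux; elim: s => [|i s IHs].
  by rewrite big_nil; apply: eq_tends (tends_cst 0) => d; rewrite big_nil.
rewrite big_cons; case Pi: (P i).
  by apply: eq_tends (tendsD (ux i) IHs) => d; rewrite big_cons Pi.
by apply: eq_tends IHs => d; rewrite big_cons Pi.
Qed.

Lemma tendsMn u x k : tends u x -> tends (fun d => u d *+ k) (x *+ k).
Proof.
move=> ux; rewrite -mulr_natr.
by apply: eq_tends (tendsM ux (tends_cst k%:R)) => d; rewrite mulr_natr.
Qed.

(* The k-th coefficient of the tail of the series is already determined by the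
   terms of index below D k.+1. *)
Lemma tends_series (y : nat -> K) : tends y 0 ->
  exists x, tends (fun d => \sum_(e < d) y e) x.
Proof.
move=> y0; have {y0} /choice[D yD] : forall n, exists D,
    forall d, (D <= d)%N -> small n (y d).
  by move=> n; have [D yD] := y0 n; exists D => d /yD; rewrite subr0.
(* From index [D 0] on the terms are power series; the finitely many earlier ones are added back
   separately. *)
have /choice[g gE] : forall i, exists f, y (i + D 0)%N = of_pseries f.
  by move=> i; apply: small0P; apply: yD; rewrite leq_addl.
pose G := PSeries (fun k => \sum_(i < D k.+1) pcoef (g i) k).
have gz i n k : (D n <= i)%N -> (k < n)%N -> pcoef (g i) k = 0.
  move=> Dni kn; apply: small_coef (kn); rewrite -gE; apply: yD.
  by rewrite (leq_trans Dni) ?leq_addr.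
exists (\sum_(e < D 0) y e + of_pseries G) => n.
exists (D n + D 0)%N => d; rewrite addnC => Dd.
have D0d : (D 0 <= d)%N by rewrite (leq_trans _ Dd) ?leq_addr.
have {}Dd : (D n <= d - D 0)%N by rewrite leq_subRL.
rewrite -(subnKC D0d); move: (d - D 0)%N Dd => {d D0d} d Dd.
rewrite big_split_ord /= opprD addrACA subrr add0r.
have -> : \sum_(i < d) y (D 0 + i)%N = of_pseries (\sum_(i < d) g i).
  by rewrite rmorph_sum; apply: eq_bigr => i _; rewrite addnC gE.
rewrite -rmorphB; apply: small_pseries => k kn.
rewrite [LHS]/= pcoef_sum.
have stab m m' : (m <= m')%N -> (forall i, (m <= i)%N -> pcoef (g i) k = 0) ->
    \sum_(i < m') pcoef (g i) k = \sum_(i < m) pcoef (g i) k.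
  move=> mm' g0; rewrite -!(big_mkord xpredT (fun i => pcoef (g i) k)).
  rewrite (big_cat_nat (leq0n m) mm') //= [X in _ + X]big_nat.
  rewrite [X in _ + X]big1 ?addr0 //.
  by move=> i /andP[/g0].
have [Dkd|dDk] := leqP (D k.+1) d.
  by rewrite (stab _ _ Dkd) ?subrr // => i /gz; apply.
by rewrite -(stab _ _ (ltnW dDk)) ?subrr // => i /(leq_trans Dd)/gz; apply.
Qed.

End InfinityAdicLimits.

(** * Convergence of the multiple power sums *)

Section MultiPowerSums.
Variable F : finFieldType.
Local Notation K := (Kinf F).

(** The reversed series of a monic polynomial is invertible, so 1/a is u^d times a power series. *)
Lemma small_of_poly_inv (a : {poly F}) d : a \is monic -> size a = d.+1 ->
  small d (of_poly a)^-1.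
Proof.
move=> a_monic sza; rewrite (of_poly_expansion (d := d)) ?sza //.
set f := PSeries _; have fU : f \is a GRing.unit.
  change (pcoef f 0 != 0); rewrite /= subn0 -[d]/(d.+1.-1) -sza -lead_coefE.
  by rewrite lead_coef_eq0 monic_neq0.
by exists f^-1; rewrite invfM mulrC (rmorphV _ fU).
Qed.

(** For z <= 0 the sums are eventually zero by [sum_npoly_expr_eq0]; for z > 0 each term is
    divisible by u^d. *)
Lemma tends_power_sum z : tends (fun d => power_sum F d z) 0.
Proof.
move=> n; case: z => [[|s]|k]; last 1 first.
(* Here z = -(k + 1), and the vanishing requires k + 1 < d. *)
- exists k.+2 => d kd; rewrite power_sumE.
  have -> : \sum_(b : {poly_d F}) of_poly ('X^d + b : {poly F}) ^ (- Negz k) =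
      of_poly (\sum_(b : {poly_d F}) ('X^d + b) ^+ k.+1).
    rewrite of_polyE !rmorph_sum /= horner_sum; apply: eq_bigr => b _.
    by rewrite rmorphXn horner_exp.
  rewrite sum_npoly_expr_eq0 // of_polyE rmorph0 horner0 subr0.
  exact: small0.
- exists 1%N => d d0; rewrite power_sumE.
  have -> : \sum_(b : {poly_d F}) of_poly ('X^d + b : {poly F}) ^ (- 0%:Z) =
      of_poly (\sum_(b : {poly_d F}) ('X^d + b) ^+ 0).
    rewrite of_polyE !rmorph_sum /= horner_sum; apply: eq_bigr => b _.
    by rewrite rmorphXn horner_exp.
  rewrite sum_npoly_expr_eq0 // of_polyE rmorph0 horner0 subr0.
  exact: small0.
exists n => d nd; rewrite subr0 /power_sum.
apply: small_sum => a /andP[am /eqP sza].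
apply: smallW nd _; have sa := small_of_poly_inv am sza.
have -> : of_poly (a : {poly F}) ^ (- s.+1%:Z) = (of_poly a)^-1 ^+ s.+1.
  by rewrite exprVn -exprnN.
elim: s => [|s IHs]; first by rewrite expr1.
by rewrite exprS; apply: smallW (smallM sa IHs); rewrite leq_addl.
Qed.

Lemma big_tuple_cons (V : nmodType) (I : finType) n (P : pred (seq I))
    (f : n.+1.-tuple I -> V) :
  \sum_(t : n.+1.-tuple I | P t) f t =
  \sum_(i : I) \sum_(t : n.-tuple I | P (i :: t)) f [tuple of i :: t].
Proof.
rewrite pair_big_dep /=.
rewrite (reindex (fun it : I * n.-tuple I => [tuple of it.1 :: it.2])) //=.
exists (fun t : n.+1.-tuple I => (thead t, [tuple of behead t]))
    => [[i t] _|t _].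
  by rewrite /= theadE; congr (_, _); apply: val_inj.
by rewrite -tuple_eta.
Qed.

(* The bound N on the entries is fixed, so that peeling off d_1 does not change
   the type of the remaining tuple. *)
Definition bounded_multi_power_sum (N d : nat) (s : seq int) : K :=
  \sum_(t : (size s).-tuple 'I_N | path gtn d (map val t))
    \prod_(j < size s) power_sum F (tnth t j) s`_j.

Lemma bounded_multi_power_sum_cons N d z s :
  bounded_multi_power_sum N d (z :: s) =
  \sum_(e < N | (e < d)%N) power_sum F e z * bounded_multi_power_sum N e s.
Proof.
rewrite /bounded_multi_power_sum.
rewrite (big_tuple_cons (fun t => path gtn d (map val t))) [RHS]big_mkcond /=.
apply: eq_bigr => e _; case: ltnP => ed /=; last by rewrite big_pred0.
rewrite big_distrr /=; apply: eq_bigr => t _.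
rewrite big_ord_recl tnth0; congr (_ * _); apply: eq_bigr => j _.
by rewrite tnthS.
Qed.

Lemma bounded_multi_power_sum_nil N d : bounded_multi_power_sum N d [::] = 1.
Proof.
rewrite /bounded_multi_power_sum (big_pred1 [tuple]) ?big_ord0 // => t.
by rewrite [t]tuple0 /= eqxx.
Qed.

(** The path condition alone forces all entries below d. *)
Lemma bounded_multi_power_sum_widen N d s : (d <= N)%N ->
  bounded_multi_power_sum N d s = bounded_multi_power_sum d d s.
Proof.
elim: s N d => [|z s IHs] N d dN; first by rewrite !bounded_multi_power_sum_nil.
rewrite !bounded_multi_power_sum_cons -(big_ord_widen N
  (fun e => power_sum F e z * bounded_multi_power_sum N e s) dN).
apply: eq_big => [e|e _]; first by rewrite ltn_ord.
by rewrite !(IHs _ e) ?(leq_trans _ dN) // ltnW.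
Qed.

Lemma bounded_multi_power_sum_diag d s :
  bounded_multi_power_sum d d s = multi_power_sum F d s.
Proof.
rewrite /bounded_multi_power_sum /multi_power_sum; apply: eq_bigl => t.
case: t => -[|i t] //= _; rewrite ltn_ord /=.
by rewrite path_map.
Qed.

Lemma multi_power_sum_cons d z s :
  multi_power_sum F d (z :: s) =
  \sum_(e < d) power_sum F e z * multi_power_sum F e s.
Proof.
rewrite -bounded_multi_power_sum_diag bounded_multi_power_sum_cons.
apply: eq_big => [e|e _].
  by rewrite ltn_ord.
by rewrite bounded_multi_power_sum_widen ?bounded_multi_power_sum_diag // ltnW.
Qed.

(** By [multi_power_sum_cons] these are partial sums of a series whose terms are S_e(z), which tends
    to 0, times a convergent sequence; hence the terms tend to 0, which suffices for convergence
    here. *)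
Lemma tends_multi_power_sum s :
  tends (fun d => multi_power_sum F d s) (zetaA F s).
Proof.
suff [x sx] : exists x, tends (fun d => multi_power_sum F d s) x.
  by rewrite /zetaA (tends_lim sx).
elim: s => [|z s [x sx]].
  exists 1; apply: eq_tends (tends_cst 1) => d.
  by rewrite multi_power_sum_nil.
have [|y zy] :=
    @tends_series _ (fun e => power_sum F e z * multi_power_sum F e s).
  by rewrite -(mul0r x); apply: tendsM => //; apply: tends_power_sum.
by exists y; apply: eq_tends zy => d; rewrite multi_power_sum_cons.
Qed.

End MultiPowerSums.

(** * Coefficients of the deformed multiple sums *)

Section Expansion.
Variable F : finFieldType.
Local Notation K := (Kinf F).
Local Notation r := #|F|.

(* D_word N w is the case B = N.+1, Z = zetaA; a bound B independent of N is
   needed to peel off the first letter. *)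
Definition binomial_expansion (B N : nat) (w : word) (Z : seq int -> K) : K :=
  \sum_(n : (size w).-tuple 'I_B | (\sum_(j < size w) tnth n j == N)%N)
    (\prod_(j < size w) (binz (- (zeta_index w)`_j) (tnth n j))%:~R) *
    Z [seq (zeta_index w)`_j - (tnth n j)%:Z * (r%:Z - 1) | j : 'I_(size w)].

(** Z is arbitrary because the shifted first exponent moves into its argument; [k <= N] keeps
    [N - k] an exact difference. *)
Lemma binomial_expansion_cons B N a w Z :
  binomial_expansion B N (a :: w) Z =
  \sum_(k < B | (k <= N)%N) (binz (- (val a)%:Z) k)%:~R *
    binomial_expansion B (N - k) w
      (fun s => Z ((val a)%:Z - k%:Z * (r%:Z - 1) :: s)).
Proof.
rewrite /binomial_expansion.
transitivity (\sum_(n : (size w).+1.-tuple 'I_B |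
      (fun t : seq 'I_B => sumn (map val t) == N)%N n)
    (\prod_(j < (size w).+1)
       (binz (- (zeta_index (a :: w))`_j) (tnth n j))%:~R) *
    Z [seq (zeta_index (a :: w))`_j - (tnth n j)%:Z * (r%:Z - 1)
      | j : 'I_(size w).+1]).
  by apply: eq_bigl => n; rewrite sumnE big_map big_tuple.
rewrite (big_tuple_cons (fun t => sumn (map val t) == N)%N).
rewrite [RHS]big_mkcond /=; apply: eq_bigr => k _.
case: leqP => kN; last first.
  by rewrite big_pred0 // => t; rewrite gtn_eqF // (leq_trans kN) ?leq_addr.
rewrite big_distrr /=; apply: eq_big => [t|t _].
  rewrite sumnE big_map big_tuple -(eqn_add2l k (\sum_(_ < _) _)).
  by rewrite subnKC.
rewrite big_ord_recl tnth0 -!mulrA; congr (_ * (_ * _)).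
  by apply: eq_bigr => j _; rewrite tnthS.
congr Z; rewrite /image_mem enum_ordSl /= tnth0 -map_comp; congr (_ :: _).
by apply: eq_map => j /=; rewrite tnthS.
Qed.

Lemma binomial_expansion_nil B Z N :
  binomial_expansion B N [::] Z = if N == 0%N then Z [::] else 0.
Proof.
rewrite /binomial_expansion big_mkcond (big_pred1 [tuple]) /=; last first.
  by move=> t; rewrite [t]tuple0 /= eqxx.
rewrite !big_ord0 eq_sym mul1r; case: ifP => // _.
by congr Z; apply: size0nil; rewrite size_map -cardE card_ord.
Qed.

Lemma binomial_expansion_sum B N w (m : nat) (c : 'I_m -> K) Z :
  binomial_expansion B N w (fun s => \sum_(e < m) c e * Z e s) =
  \sum_(e < m) c e * binomial_expansion B N w (Z e).
Proof.
under [RHS]eq_bigr do rewrite big_distrr /=.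
rewrite [RHS]exchange_big /=; apply: eq_bigr => n _.
by rewrite big_distrr /=; apply: eq_bigr => e _; rewrite mulrCA.
Qed.

(** The bound 1 forces every n_j to be 0. *)
Lemma binomial_expansion0 w Z : binomial_expansion 1 0 w Z = Z (zeta_index w).
Proof.
elim: w Z => [|a w IHw] Z; first by rewrite binomial_expansion_nil.
rewrite binomial_expansion_cons big_mkcond big_ord1 /= IHw binz0r mul1r.
by rewrite mul0r subr0.
Qed.

(** The Cauchy product in T distributes N between the first power sum and the shorter multiple sum,
    just as [binomial_expansion_cons] distributes it between the first letter and the rest. *)
Lemma pcoef_msum B d w N : (N < B)%N ->
  pcoef (msum (psum (@deform F)) d w) N =
  binomial_expansion B N w (multi_power_sum F d).
Proof.
elim: w d N => [|a w IHw] d N NB.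
  rewrite binomial_expansion_nil multi_power_sum_nil /=.
  by case: eqP.
rewrite msum_cons pcoef_sum binomial_expansion_cons.
transitivity (\sum_(k < B | (k <= N)%N) \sum_(e < d)
    (binz (- (val a)%:Z) k)%:~R *
    (power_sum F e ((val a)%:Z - k%:Z * (r%:Z - 1)) *
     binomial_expansion B (N - k) w (multi_power_sum F e))); last first.
  apply: eq_bigr => k _; rewrite -big_distrr -binomial_expansion_sum /=.
  congr (_ * binomial_expansion _ _ _ _); apply/funext => s.
  by rewrite multi_power_sum_cons.
rewrite [RHS]exchange_big /=; apply: eq_bigr => e _.
(* As N < B, the k < B with k <= N are exactly the indices of the Cauchy product. *)
rewrite -(big_ord_widen B (fun k => (binz (- (val a)%:Z) k)%:~R *
  (power_sum F e ((val a)%:Z - k%:Z * (r%:Z - 1)) *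
   binomial_expansion B (N - k) w (multi_power_sum F e))) NB).
apply: eq_bigr => k _; rewrite pcoef_psum IHw ?mulrA //.
by rewrite (leq_ltn_trans (leq_subr _ _)).
Qed.

Lemma tends_pcoef_msum w N :
  tends (fun d => pcoef (msum (psum (@deform F)) d w) N) (D_word F N w).
Proof.
have : tends (fun d => binomial_expansion N.+1 N w (multi_power_sum F d))
    (D_word F N w).
  apply: tends_sum => n; apply: tendsM; first exact: tends_cst.
  exact: tends_multi_power_sum.
by apply: eq_tends => d; rewrite (pcoef_msum _ _ (ltnSn N)).
Qed.

Lemma tends_pcoef_wlin_msum p (x : shuffle_alg p) N :
  tends (fun d => pcoef (wlin (msum (psum (@deform F)) d) x) N) (D_map F N x).
Proof.
have : tends (fun d => \sum_(w <- dom x)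
    pcoef (msum (psum (@deform F)) d w) N *+ (coeff w x : 'F_p)) (D_map F N x).
  by apply: tends_sum => w; apply: tendsMn; apply: tends_pcoef_msum.
apply: eq_tends => d; rewrite pcoef_sum.
by apply: eq_bigr => w _; rewrite pcoefMn.
Qed.

Lemma D_map0 p : @D_map p F 0 = @zetahat p F.
Proof.
apply/funext => x; apply: eq_bigr => w _.
congr (_ *+ _); exact: binomial_expansion0.
Qed.

Lemma Zinf_D_map p N (x : shuffle_alg p) : Zinf (D_map F N x).
Proof.
move=> S [[SK SD SM] Szeta].
(* The binomial coefficients act through integers, which lie in F(theta). *)
have Sint (z : int) : S z%:~R.
  apply: SK; exists z%:~R, 1; split; first exact: oner_neq0.
  by rewrite of_poly1 of_poly_int divr1.
have Ssum (I : Type) (s : seq I) (P : pred I) (f : I -> K) :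
    (forall i, S (f i)) -> S (\sum_(i <- s | P i) f i).
  move=> Sf; elim/big_ind: _ => //; first exact: (Sint 0).
have SMn (y : K) n : S y -> S (y *+ n).
  by move=> Sy; rewrite -mulr_natr; apply: SM => //; apply: (Sint n%:Z).
apply: (Ssum) => w; apply: SMn; apply: Ssum => n; apply: (SM).
  elim/big_ind: _ => [|y z|j _]; [exact: (Sint 1)|exact: SM|exact: Sint].
by apply: Szeta; exists [seq (zeta_index w)`_j - (tnth n j)%:Z * (r%:Z - 1)
  | j : 'I_(size w)].
Qed.

End Expansion.

Theorem theorem4p18 (p e : nat) (F : finFieldType)
    (p_prime : prime p) (e_gt0 : (0 < e)%N) (cardF : #|F| = (p ^ e)%N) :
  [/\ forall (N : nat) (x : shuffle_alg p), Zinf (D_map F N x),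
      Hasse_Schmidt (@zetahat p F) (@D_map p F) &
      forall (u v : word) (N : nat),
        D_map F N (shuffle #|F| (xmon u) (xmon v) : shuffle_alg p) =
        \sum_(k < N.+1)
          D_map F k (xmon u : shuffle_alg p) *
          D_map F (N - k)%N (xmon v : shuffle_alg p)].
Proof.
(* Both sides are limits of the N-th coefficient of one identity between power series in T,
   [wlin_msum_shuffle]; the sum over k is its Cauchy product. *)
have D_shuffle N (x y : shuffle_alg p) : D_map F N (shuffle #|F| x y) =
    \sum_(k < N.+1) D_map F k x * D_map F (N - k)%N y.
  rewrite -(tends_lim (tends_pcoef_wlin_msum F (shuffle #|F| x y) N)).
  apply: tends_lim; set u := fun d => _.
  have : tends (fun d => \sum_(k < N.+1)
      pcoef (wlin (msum (psum (@deform F)) d) x) k *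
      pcoef (wlin (msum (psum (@deform F)) d) y) (N - k))
      (\sum_(k < N.+1) D_map F k x * D_map F (N - k)%N y).
    by apply: tends_sum => k; apply: tendsM; apply: tends_pcoef_wlin_msum.
  apply: eq_tends => d; rewrite /u (wlin_msum_shuffle p_prime) //.
    exact: mulrn_pseries_Kinf p_prime cardF.
  move=> d' m n m0 n0.
  pose H := psum_mul (deformB p_prime cardF) (@deformZ F) (@deform_unit F).
  exact: (H d' m n m0 n0).
have D_linear N : Fp_linear (@D_map p F N).
  by move=> c x y; apply: wlin_linear => //; apply: mulrn_Kinf p_prime cardF.
split=> [N x||u v N]; [exact: Zinf_D_map | | exact: D_shuffle].
split=> //; last exact: D_map0.
(* Multiplicativity of [zetahat] is the case N = 0. *)
rewrite -D_map0; split=> // [|x y]; first exact: D_map_nil.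
by rewrite D_shuffle big_ord1.
Qed.
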